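(* For every $k\ge2$, $$g^{\rm comb}_k(x)=g^{\rm comb}_1(x)\cdot\big(s\,x\,\partial_x-1\big)g^{\rm comb}_{k-1}(x),$$ where for $k\ge1$, $g^{\rm comb}_k(x)=\sum_{C\in\mathcal R_{\rm dec},\,b(C)\ge k}\omega_C\,\hat a_C\,a_{d_{b(C)},b(C)-k}\,x^{\|C\|}\in A[[x]]$.
   Context: Fix a commutative $\mathbb Q$-algebra $A$, an integer $s$, and elements $a_{k,i}\in A$ ($k\ge1$, $i\ge0$). For $y$ and $n\ge0$, $\binom{y}{n}=y(y-1)\cdots(y-n+1)/n!$. Chord diagrams. A rooted chord diagram of size $n$ is a fixed-point-free involution $C$ of $\{1,\dots,2n\}$, viewed as $n$ chords (transpositions) $(x\,y)$ with $x<y$; the chord containing $1$ is the root chord; $|C|=n$. Chords $(x\,y),(x'\,y')$ cross if $x<x'<y<y'$ or $x'<x<y'<y$. $C$ is connected if the graph whose vertices are the chords, with edges joining crossing chords, is connected. For a set of $m$ chords with $2m$ distinct positive integer endpoints, $\mathrm{norm}$ of it is the chord diagram on $\{1,\dots,2m\}$ obtained by replacing each endpoint by its rank among the $2m$ endpoints. Intersection order. The chords of a rooted connected chord diagram of size $n$ are labeled $1,\dots,n$ recursively: the root chord gets the first available label; the remaining chords split into connected components (w.r.t. crossing); the components are processed in increasing order of their smallest endpoint, each regarded as a rooted connected chord diagram rooted at its chord with smallest endpoint and labeled recursively with the next block of consecutive labels. ''Chord $i$'' means the chord with label $i$. Terminal and base chords. Chord $i$ is terminal if it crosses no chord $j$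 with $j>i$. If $t_0<t_1<\dots<t_m$ are the terminal labels, the base chord is $b(C)=t_0$. Insertion of chord diagrams. For $C$ of size $n$ with chords $(x_1y_1),\dots,(x_ny_n)$, root $(x_1y_1)$ ($x_1=1$), $D$ of size $m$ with chords $(x'_iy'_i)$, and $1\le k\le 2m-1$, $C\circ_kD$ is the chord diagram of size $n+m$ with chords $(1,y_1+k)$, $(x_i+k,y_i+k)$ ($2\le i\le n$), $(H(x'_i),H(y'_i))$ ($1\le i\le m$), where $H(x)=x+1$ if $x\le k$ and $H(x)=x+2n$ otherwise. Root share decomposition. For rooted connected $C$ with $|C|\ge2$, let $C_1$ be the connected component (of the chords other than the root) having the smallest endpoint among such components. There is a unique $i$ with $C=C'\circ_iC''$, where $C'=\mathrm{norm}(C\setminus C_1)$, $C''=\mathrm{norm}(C_1)$. Trees. Trees are rooted plane binary trees (every non-leaf vertex has a left and a right child) with labeled leaves. For such $T,T'$ with $T'$ having $\ell$ leaves and $1\le k\le2\ell-1$: add a virtual edge above the root of $T'$, number it $1$, and number the other $2\ell-2$ edges $2,3,\dots$ in pre-order of their lower endpoints (left subtree before right). $T\circ_kT'$ is obtained by subdividing edge $k$ of $T'$ by a new vertex $v$, making the part of $T'$ below edge $k$ the right subtree of $v$ and $T$ the left subtree of $v$; leaf labels are kept. Insertion tree. If $|C|=1$, $T(C)$ is a single vertex labeled by the label of its chord; if $|C|\ge2$ with root share decomposition $C=C'\circ_iC''$, then $T(C)=T(C')\circ_iT(C'')$, where the leaves of $T(C'),T(C'')$ carry the intersection-order labels in $C$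 of the corresponding chords. Branch-left vector. For a leaf $v$, $\nu_v$ is the number of edges in the path starting at $v$ and repeatedly moving to the parent as long as the current vertex is a right child. $\nu_i(C)$ is $\nu_v$ for the leaf $v$ of $T(C)$ labeled $i$. Decorations. A decorated chord diagram is a rooted connected chord diagram with a positive integer $d_i$ on each chord $i$; $\|C\|=\sum_id_i$; $\mathcal R_{\rm dec}$ is the set of all of them (labels, terminal chords, $T(C)$, $\nu$ ignore decorations). Weight and monomial. $\omega_C=\prod_{i=1}^{|C|}\binom{sd_i+\nu_i(C)-2}{\nu_i(C)}$. With terminal labels $t_0<\dots<t_m$, $\hat a_C=\prod_{c=1}^m a_{d_{t_c},t_c-t_{c-1}}\cdot\prod_{i\text{ non-terminal}}a_{d_i,0}$. *)

(* Defs.v *)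
From HB Require Import structures.
From mathcomp Require Import all_boot all_order all_fingroup all_algebra.
Set Implicit Arguments. Unset Strict Implicit. Unset Printing Implicit Defensive.
Import Order.TTheory GRing.Theory Num.Theory.

(* ---------- chord diagrams: chords are pairs (x, y) with x < y ---------- *)
Definition chord := (nat * nat)%type.

Definition cross (c c' : chord) : bool :=
  [&& c.1 < c'.1, c'.1 < c.2 & c.2 < c'.2] || [&& c'.1 < c.1, c.1 < c'.2 & c'.2 < c.2].

Definition sortC (D : seq chord) : seq chord := sort (fun c c' : chord => c.1 <= c'.1) D.

Fixpoint grow (fuel : nat) (D K : seq chord) : seq chord :=
  match fuel with
  | 0 => K
  | f.+1 => grow f D [seq e <- D | (e \in K) || has (cross e) K]
  end.

(* connected components of D (D sorted by left endpoint), listed in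
   increasing order of their smallest endpoint *)
Fixpoint comps_rec (fuel : nat) (D : seq chord) : seq (seq chord) :=
  match fuel, D with
  | f.+1, c :: _ =>
      let K := grow (size D) D [:: c] in K :: comps_rec f [seq e <- D | e \notin K]
  | _, _ => [::]
  end.

Definition comps (D : seq chord) : seq (seq chord) := comps_rec (size D) (sortC D).

Definition connectedb (D : seq chord) : bool := size (comps D) == 1.

(* intersection order: the list of chords, chord with label i at position i-1 *)
Fixpoint iorder (fuel : nat) (C : seq chord) : seq chord :=
  match fuel with
  | 0 => [::]
  | f.+1 =>
      match sortC C with
      | [::] => [::]
      | r :: rest => r :: flatten [seq iorder f K | K <- comps rest]
      end
  end.

Definition iord (C : seq chord) : seq chord := iorder (size C) C.

Definition chord_of (C : seq chord) (i : nat) : chord := nth (0, 0) (iord C) i.-1.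

Definition terminals (C : seq chord) : seq nat :=
  [seq i <- iota 1 (size C) |
    ~~ has (fun j => cross (chord_of C j) (chord_of C i)) (iota i.+1 (size C - i))].

Definition base (C : seq chord) : nat := head 0 (terminals C).

Definition endpoints (D : seq chord) : seq nat := flatten [seq [:: c.1; c.2] | c <- D].
Definition rankE (D : seq chord) (e : nat) : nat := (count (fun e' => e' < e) (endpoints D)).+1.
Definition norm (D : seq chord) : seq chord := [seq (rankE D c.1, rankE D c.2) | c <- D].

(* insertion C o_k D of chord diagrams (root of C is the chord with x = 1) *)
Definition insertCD (C : seq chord) (k : nat) (D : seq chord) : seq chord :=
  let H x := if x <= k then x.+1 else x + (size C).*2 in
  [seq (if c.1 == 1 then (1, c.2 + k) else (c.1 + k, c.2 + k)) | c <- C]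
    ++ [seq (H c.1, H c.2) | c <- D].

Inductive btree := BLeaf of chord | BNode of btree & btree.

Fixpoint tsize (t : btree) : nat :=
  match t with BLeaf _ => 1 | BNode l r => (tsize l + tsize r).+1 end.

Fixpoint tmap (f : chord -> chord) (t : btree) : btree :=
  match t with BLeaf c => BLeaf (f c) | BNode l r => BNode (tmap f l) (tmap f r) end.

(* T o_k T' : edge k of T' (edge 1 = virtual edge above the root, the other edges
   numbered in pre-order of their lower endpoints) is the edge above the k-th
   vertex of T' in pre-order; it is subdivided by a new vertex v whose left
   subtree is T and whose right subtree is the part of T' below edge k. *)
Fixpoint tinsert (T : btree) (k : nat) (T' : btree) : btree :=
  if k == 1 then BNode T T' else
  match T' with
  | BLeaf _ => T'
  | BNode l r =>
      if k.-1 <= tsize l then BNode (tinsert T k.-1 l) r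
      else BNode l (tinsert T (k.-1 - tsize l) r)
  end.

(* insertion tree T(C) of a (normalized) rooted connected chord diagram C;
   its leaves carry the chords of C *)
Fixpoint treeOf (fuel : nat) (C : seq chord) : btree :=
  match fuel with
  | 0 => BLeaf (0, 0)
  | f.+1 =>
      match sortC C with
      | [::] => BLeaf (0, 0)
      | [:: c] => BLeaf c
      | r :: rest =>
          let C1 := head [::] (comps rest) in
          let Cp := [seq c <- C | c \notin C1] in
          let Np := norm Cp in
          let Npp := norm C1 in
          let i := head 0 [seq k <- iota 1 ((size Npp).*2.-1) |
                             perm_eq (insertCD Np k Npp) C] in
          tinsert (tmap (fun c => nth (0, 0) Cp (index c Np)) (treeOf f Np)) i
                  (tmap (fun c => nth (0, 0) C1 (index c Npp)) (treeOf f Npp))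
      end
  end.

Definition insTree (C : seq chord) : btree := treeOf (size C) C.

Fixpoint nus (t : btree) (r : nat) : seq (chord * nat) :=
  match t with
  | BLeaf c => [:: (c, r)]
  | BNode l rr => nus l 0 ++ nus rr r.+1
  end.

Definition nu (C : seq chord) (i : nat) : nat :=
  let L := nus (insTree C) 0 in
  nth 0 (map snd L) (index (chord_of C i) (map fst L)).

(* chord diagram of size m given as a permutation of {1..2m} (shifted to 'I_(2m)) *)
Definition is_cd (m : nat) (sg : {perm 'I_(m.*2)}) : bool :=
  [forall i, (sg (sg i) == i) && (sg i != i)].

Definition chords_of (m : nat) (sg : {perm 'I_(m.*2)}) : seq chord :=
  [seq ((val i).+1, (val (sg i)).+1) | i <- [seq j <- enum 'I_(m.*2) | val j < val (sg j)]].

(* decoration d as function of labels: d_i for label i *)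
Definition decf (m n : nat) (d : {ffun 'I_m -> 'I_n.+1}) (i : nat) : nat :=
  nth 0 [seq val (d j) | j <- enum 'I_m] i.-1.

Local Open Scope ring_scope.

Definition binq (y : rat) (n : nat) : rat := (\prod_(j < n) (y - j%:R)) / (n`!)%:R.

Definition omega (s : int) (C : seq chord) (dec : nat -> nat) : rat :=
  \prod_(1 <= i < (size C).+1)
     binq ((s * (dec i)%:Z)%:~R + (nu C i)%:R - 2%:R) (nu C i).

Definition ahat (A : comAlgType rat) (a : nat -> nat -> A) (C : seq chord)
    (dec : nat -> nat) : A :=
  (\prod_(p <- zip (behead (terminals C)) (terminals C)) a (dec p.1) (p.1 - p.2)%N)
  * \prod_(1 <= i < (size C).+1 | i \notin terminals C) a (dec i) 0%N.

Definition gterm (A : comAlgType rat) (s : int) (a : nat -> nat -> A) (k : nat)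
    (C : seq chord) (dec : nat -> nat) : A :=
  if (k <= base C)%N then
    omega s C dec *: (ahat a C dec * a (dec (base C)) (base C - k)%N)
  else 0.

Definition gcoef (A : comAlgType rat) (s : int) (a : nat -> nat -> A) (k n : nat) : A :=
  \sum_(1 <= m < n.+1)
    \sum_(sg : {perm 'I_(m.*2)} | is_cd sg && connectedb (chords_of sg))
      \sum_(d : {ffun 'I_m -> 'I_n.+1} |
              [forall j, (0 < val (d j))%N] && ((\sum_(j < m) val (d j))%N == n))
        gterm s a k (chords_of sg) (decf d).

(* Main.v *)
Require Import Defs.
From HB Require Import structures.
From mathcomp Require Import all_boot all_order all_fingroup all_algebra.
From mathcomp Require Import zify ring.
Set Implicit Arguments. Unset Strict Implicit. Unset Printing Implicit Defensive.
Import Order.TTheory GRing.Theory Num.Theory.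

(** The root share decomposition [C = C' o_i C''] is a bijection between connected
diagrams of size at least 2 and triples [(C', C'', i)] with
[1 <= i <= 2|C''| - 1].  In the intersection order of [C], the labels of [C''] are
inserted just after the root of [C'], hence [b(C) = b(C'') + 1], and
the monomial attached to [C] at level [k >= 2] is the product of the monomial of [C']
at level 1 and that of [C''] at level [k - 1]; neither depends on [i].
On the tree side, inserting at edge [i] leaves the branch-left vector of [C'] unchanged and
increases one entry of that of [C'']: the one of the rightmost leaf [u] below edge [i].
As there are [nu_u + 1] such edges and
[(nu + 1) binom(s d + nu - 1, nu + 1) = (s d + nu - 1) binom(s d + nu - 2, nu)],
summing the weight over [i] gives
[omega_C' omega_C'' sum_u (s d_u + nu_u - 1) = omega_C' omega_C'' (s ||C''|| - 1)],
because the entries of the branch-left vector add up to [|C''| - 1]. *)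

(** Why the monomial factors: some chord of [C''] straddles the cut [i], so the root of [C] crosses
    it and label 1 is not terminal; the other chords of [C'] cross no chord of [C''], so their
    terminal status survives. The last label of [C''] is terminal, so the gap before the next
    terminal chord coming from [C'] is measured from there, exactly as it is measured from label 1
    in [C']. This is why [C'] enters at level 1. Diagrams with one chord have base 1 and drop out
    for [k >= 2].

    The obstacle is that components, labels and trees are computed by fuelled recursions on lists of
    chords whose endpoints are shifted by insertion. Both parts of [C] are images under strictly
    increasing maps, every construction commutes with such maps, and [norm] undoes them. Diagrams
    are kept as sorted lists and decorations as words in label order, so the bijection becomes a
    permutation of duplicate-free lists. The sum over edges is then an induction on trees that
    remember only decorations. *)

Definition lec (c c' : chord) : bool := c.1 <= c'.1.

Lemma lec_total : total lec.
Proof. by move=> c c'; apply: leq_total. Qed.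

Lemma lec_trans : transitive lec.
Proof. by move=> c c' c''; apply: leq_trans. Qed.

Lemma crossC c c' : cross c c' = cross c' c.
Proof. by rewrite /cross orbC. Qed.

Lemma perm_sortC D : perm_eq (sortC D) D.
Proof. by rewrite /sortC perm_sort. Qed.

Lemma mem_sortC D : sortC D =i D.
Proof. by move=> c; rewrite (perm_mem (perm_sortC D)). Qed.

Lemma size_sortC D : size (sortC D) = size D.
Proof. exact: size_sort. Qed.

Lemma sortC_sorted D : sorted lec (sortC D).
Proof. exact: (sort_sorted lec_total). Qed.

Lemma sorted_sortC D : sorted lec D -> sortC D = D.
Proof. exact: (sorted_sort lec_trans). Qed.

Lemma sortC_filter p D : sortC (filter p D) = filter p (sortC D).
Proof. by rewrite /sortC (filter_sort lec_total lec_trans). Qed.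

Lemma uniq_fst_inj (D : seq chord) : uniq (map fst D) ->
  {in D &, forall c c' : chord, c.1 = c'.1 -> c = c'}.
Proof.
elim: D => //= a D IH /andP[aD uD] c c'; rewrite !inE.
case/orP=> [/eqP ->|cD] /orP[/eqP ->|c'D] // e; last exact: IH.
- by case/mapP: aD; exists c'.
- by case/mapP: aD; exists c.
Qed.

(** [lec] compares left endpoints only, so it is antisymmetric, and the sorted list unique, only
    where left endpoints are distinct. *)
Lemma sortC_eq D E : uniq (map fst D) -> perm_eq D E -> sorted lec E -> sortC D = E.
Proof.
move=> u pDE sE.
apply: (@sorted_eq_in _ lec); last 1 first.
- by rewrite (perm_trans (perm_sortC D)).
- by move=> x y z _ _ _; apply: lec_trans.
- move=> x y; rewrite !mem_sortC => xD yD /andP[] h1 h2.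
  by apply: (uniq_fst_inj u) => //; apply/eqP; rewrite eqn_leq [_ <= _]h1.
- exact: sortC_sorted.
- exact: sE.
Qed.

(** * Connected components *)

Definition cross_closed (D : seq chord) (X : pred chord) :=
  forall c c', c \in D -> c' \in D -> cross c c' -> X c -> X c'.

(** Connectedness without paths: a crossing-stable predicate is all or nothing on [D]. Arguments
    that propagate a property along crossings then need no induction on walks. *)
Definition conn (D : seq chord) :=
  forall X : pred chord, cross_closed D X ->
    forall c c', c \in D -> c' \in D -> X c -> X c'.

Lemma cross_closedC D X : cross_closed D X -> cross_closed D (predC X).
Proof.
move=> cl c c' cD c'D cc' /=; apply: contra => Xc'.
by apply: (cl c' c) => //; rewrite crossC.
Qed.

(** As crossing is symmetric, a stable predicate failing at [c0] has a stable complement holding at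
    [c0]; hence one base chord is enough. *)
Lemma conn_from D c0 : c0 \in D ->
  (forall X, cross_closed D X -> X c0 -> {in D, forall c, X c}) -> conn D.
Proof.
move=> c0D H X cl c c' cD c'D Xc.
case: (boolP (X c0)) => Xc0; first exact: H.
have := H _ (cross_closedC cl) Xc0 c cD; by rewrite /= Xc.
Qed.

Lemma eq_conn D E : D =i E -> conn D -> conn E.
Proof.
move=> DE cD X cl c c'; rewrite -!DE; apply: cD => x y xD yD; apply: cl; by rewrite -DE.
Qed.

Definition grow_step (D K : seq chord) := [seq e <- D | (e \in K) || has (cross e) K].

Lemma growS f D K : grow f.+1 D K = grow f D (grow_step D K).
Proof. by []. Qed.

Lemma sub_grow_step D K : {subset K <= D} -> {subset K <= grow_step D K}.
Proof. by move=> s c cK; rewrite mem_filter cK s. Qed.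

Lemma grow_step_sub D K : {subset grow_step D K <= D}.
Proof. by move=> c; rewrite mem_filter => /andP[]. Qed.

Lemma sub_grow f D K : {subset K <= D} -> {subset K <= grow f D K}.
Proof.
elim: f K => [|f IH] K s //=; move=> c cK; apply: IH; first exact: grow_step_sub.
exact: sub_grow_step.
Qed.

Lemma grow_sub f D K : {subset K <= D} -> {subset grow f D K <= D}.
Proof. elim: f K => [|f IH] K s //=; apply: IH; exact: grow_step_sub. Qed.

Lemma grow_min f D K X : {subset K <= D} -> cross_closed D X -> {in K, forall c, X c} ->
  {in grow f D K, forall c, X c}.
Proof.
elim: f K => [|f IH] K s cl XK //=; apply: IH => //; first exact: grow_step_sub.
move=> c; rewrite mem_filter => /andP[/orP[cK _|/hasP[e eK ce] cD]]; first exact: XK.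
by apply: (cl e c) => //; [exact: s | rewrite crossC | exact: XK].
Qed.

Lemma grow_step_closed D K : {subset K <= D} ->
  cross_closed D (mem K) -> grow_step D K =i K.
Proof.
move=> s cl c; rewrite mem_filter; apply/andP/idP => [[/orP[] // /hasP[e eK ce] cD]|cK].
  by apply: (cl e c) => //; [exact: s | rewrite crossC].
by rewrite cK s.
Qed.

Lemma grow_stable f D K : {subset K <= D} -> cross_closed D (mem K) ->
  cross_closed D (mem (grow f D K)).
Proof.
elim: f K => [|f IH] K s cl //=; apply: IH; first exact: grow_step_sub.
by move=> c c' cD c'D cc'; rewrite /= !grow_step_closed //; apply: cl.
Qed.

(** Each round either adds a chord, which pays for one unit of fuel since [K] stays inside [D], or
    is stationary, and a stationary set is closed. *)
Lemma grow_closed f D K : uniq D -> uniq K -> {subset K <= D} -> size D <= f + size K ->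
  cross_closed D (mem (grow f D K)).
Proof.
elim: f K => [|f IH] K uD uK s le; last rewrite growS.
  have [_ e] := uniq_min_size uK s le.
  by move=> c c' cD c'D _ _ /=; rewrite e.
have uK1 : uniq (grow_step D K) by apply: filter_uniq.
have sK1 := sub_grow_step s.
case: (ltnP (size K) (size (grow_step D K))) => lt.
  apply: IH => //; [exact: grow_step_sub | lia].
have [_ e] := uniq_min_size uK sK1 lt.
apply: grow_stable; first exact: grow_step_sub.
move=> c c' cD c'D cc' /=; rewrite -!e => cK.
rewrite e mem_filter c'D andbT; apply/orP; right; apply/hasP; exists c => //; by rewrite crossC.
Qed.

Lemma grow_filter f D K : 0 < f -> exists p, grow f D K = filter p D.
Proof.
elim: f K => [|[|f] IH] K // _; first by exists (fun e => (e \in K) || has (cross e) K).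
by rewrite growS; apply: IH.
Qed.

Definition component (D : seq chord) (c : chord) := grow (size D) D [:: c].

Lemma mem_component D c : c \in D -> c \in component D c.
Proof. by move=> cD; apply: sub_grow (mem_head _ _) => x; rewrite mem_seq1 => /eqP ->. Qed.

Lemma component_sub D c : c \in D -> {subset component D c <= D}.
Proof. by move=> cD; apply: grow_sub => x; rewrite mem_seq1 => /eqP ->. Qed.

Lemma component_closed D c : uniq D -> c \in D -> cross_closed D (mem (component D c)).
Proof.
move=> uD cD; apply: grow_closed => //; last by rewrite addn1.
by move=> x; rewrite mem_seq1 => /eqP ->.
Qed.

Lemma component_min D c X : c \in D -> cross_closed D X -> X c ->
  {in component D c, forall e, X e}.
Proof.
move=> cD cl Xc; apply: grow_min => //; first by move=> x; rewrite mem_seq1 => /eqP ->.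
by move=> x; rewrite mem_seq1 => /eqP ->.
Qed.

(** A single round of [grow] already returns a filter of [D]; thus a component inherits the order of
    [D]. The fuel is positive because [D] contains [c]. *)
Lemma component_filter D c : c \in D -> component D c = [seq e <- D | e \in component D c].
Proof.
move=> cD; have : 0 < size D by case: (D) cD.
case/(grow_filter D [:: c]) => p; rewrite -/(component D c) => e.
rewrite e; apply: eq_in_filter => x xD; by rewrite mem_filter xD andbT.
Qed.

Lemma component_eq D c (X : pred chord) : uniq D -> c \in D -> X c -> cross_closed D X ->
  (forall Y, cross_closed D Y -> Y c -> {in D, forall e, X e -> Y e}) ->
  component D c = filter X D.
Proof.
move=> uD cD Xc cl H; rewrite component_filter //; apply: eq_in_filter => x xD.
apply/idP/idP => [/(component_min cD cl Xc) //|Xx].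
apply: (H (mem (component D c))) => //; [exact: component_closed | exact: mem_component].
Qed.

Lemma component_conn D c : uniq D -> c \in D -> conn (component D c).
Proof.
move=> uD cD; apply: (conn_from (mem_component cD)) => X cl Xc e eK.
have: X e && (e \in component D c).
  apply: (@component_min D c (fun e => X e && (e \in component D c))) => //.
    move=> a b aD bD ab /andP[Xa aK].
    have bK : b \in component D c by apply: (component_closed uD cD aD bD ab).
    by rewrite bK (cl a b).
  by rewrite Xc mem_component.
by case/andP.
Qed.

Lemma comps_recS f c D : comps_rec f.+1 (c :: D) =
  component (c :: D) c :: comps_rec f [seq e <- c :: D | e \notin component (c :: D) c].
Proof. by []. Qed.

Lemma size_comps_rest c D :
  size [seq e <- c :: D | e \notin component (c :: D) c] <= size D.
Proof. by rewrite /= mem_component ?mem_head //= size_filter count_size. Qed.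

Lemma comps_rec_fuel f D : size D <= f -> comps_rec f D = comps_rec (size D) D.
Proof.
have [n] := ubnP (size D); elim: n f D => // n IH [|f] [|c D] // lt le.
rewrite [size (c :: D)]/= !comps_recS; congr (_ :: _).
move: [seq e <- _ | _] (size_comps_rest c D) => R leR.
by rewrite (IH f R) ?(IH (size D) R) ?(leq_trans leR) ?(leq_ltn_trans leR).
Qed.

Lemma comps_sorted D : sorted lec D -> comps D = comps_rec (size D) D.
Proof. by move=> s; rewrite /comps sorted_sortC. Qed.

Lemma comps_cons c D : sorted lec (c :: D) ->
  comps (c :: D) = component (c :: D) c ::
    comps [seq e <- c :: D | e \notin component (c :: D) c].
Proof.
move=> s; rewrite (comps_sorted s) comps_recS comps_sorted; last exact: (sorted_filter lec_trans).
congr (_ :: _); apply: comps_rec_fuel; exact: size_comps_rest.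
Qed.

Lemma comps_rec_perm f D : size D <= f -> perm_eq (flatten (comps_rec f D)) D.
Proof.
elim: f D => [|f IH] [|c D] //; rewrite comps_recS [flatten _]/= => le.
rewrite {1}component_filter ?mem_head //.
apply: perm_trans (permEl (perm_filterC [in component (c :: D) c] (c :: D))).
by rewrite perm_cat2l; apply: IH; apply: leq_trans (size_comps_rest c D) _.
Qed.

Lemma comps_perm D : perm_eq (flatten (comps D)) D.
Proof. by rewrite (perm_trans _ (perm_sortC D)) // comps_rec_perm // size_sortC. Qed.

Lemma size_comps D K : K \in comps D -> size K <= size D.
Proof.
move=> KD; rewrite -(perm_size (comps_perm D)) size_flatten.
elim: (comps D) KD => //= a s IH; rewrite inE => /orP[/eqP ->|/IH]; lia.
Qed.

(** There is exactly one component when removing the first one leaves nothing, that is, when the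
    component of the first chord exhausts [D]. *)
Lemma connectedP D : uniq D -> reflect (D <> [::] /\ conn D) (connectedb D).
Proof.
move=> uD; rewrite /connectedb /comps.
have e : sortC D =i D by apply: mem_sortC.
have uS : uniq (sortC D) by rewrite (perm_uniq (perm_sortC D)).
have sz := size_sortC D.
case E: (sortC D) => [|c S].
  rewrite -sz E /=; apply: ReflectF; case; rewrite E in sz; by case: (D) sz.
rewrite -sz E comps_recS; rewrite !E in e uS.
have nD : D <> [::] by move=> D0; rewrite D0 in E.
have cS := mem_head c S.
set R := [seq _ <- _ | _].
have -> : (size (component (c :: S) c :: comps_rec (size S) R) == 1) = (R == [::]).
  rewrite /= eqSS size_eq0; have : size R <= size S by apply: size_comps_rest.
  by case: (size S) (R) => [|n] [].
apply: (iffP eqP) => [R0|[_ cD]].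
  split=> //; apply: (eq_conn e); apply: eq_conn (component_conn uS cS) => x.
  apply/idP/idP => [xK|xS]; first exact: (component_sub cS xK).
  by have := in_nil x; rewrite -R0 mem_filter xS andbT => /negPn.
apply/eqP; rewrite -size_eq0 size_filter -leqn0 leqNgt -has_count; apply/hasPn => x xS /=.
rewrite negbK; apply: (eq_conn (fsym e) cD (component_closed uS cS) cS xS).
exact: mem_component.
Qed.

(** * Strictly increasing relabelings of endpoints *)

Definition hmap (h : nat -> nat) (c : chord) : chord := (h c.1, h c.2).

Lemma endpoints_hmap h D : endpoints (map (hmap h) D) = map h (endpoints D).
Proof. by elim: D => //= c D; rewrite /endpoints /= => ->. Qed.

Lemma perm_endpoints D E : perm_eq D E -> perm_eq (endpoints D) (endpoints E).
Proof. by move=> p; apply: perm_flatten; apply: perm_map. Qed.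

Lemma endpoints_cat D E : endpoints (D ++ E) = endpoints D ++ endpoints E.
Proof. by rewrite /endpoints map_cat flatten_cat. Qed.

Lemma size_endpoints D : size (endpoints D) = (size D).*2.
Proof. by elim: D => //= c D; rewrite /endpoints /= => ->. Qed.

Section Monotone.
Variable h : nat -> nat.
Hypothesis hM : {mono h : x y / x <= y}.

Lemma hmap_inj : injective (hmap h).
Proof. by move=> [a b] [c d] [/(incn_inj hM) -> /(incn_inj hM) ->]. Qed.

Lemma cross_hmap c c' : cross (hmap h c) (hmap h c') = cross c c'.
Proof. by rewrite /cross /= !(leqW_mono hM). Qed.

Lemma lec_hmap c c' : lec (hmap h c) (hmap h c') = lec c c'.
Proof. exact: hM. Qed.

Lemma sortC_hmap D : sortC (map (hmap h) D) = map (hmap h) (sortC D).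
Proof. symmetry; apply: (map_sort (leT' := lec) (leT := lec)) => c c'; exact: hM. Qed.

Lemma sorted_hmap D : sorted lec (map (hmap h) D) = sorted lec D.
Proof. by rewrite sorted_map /=; apply: eq_sorted => c c'; apply: lec_hmap. Qed.

Lemma grow_hmap f D K :
  grow f (map (hmap h) D) (map (hmap h) K) = map (hmap h) (grow f D K).
Proof.
elim: f K => //= f IH K; rewrite -IH; congr grow.
rewrite filter_map; congr map; apply: eq_filter => c /=.
rewrite (mem_map hmap_inj) has_map; congr (_ || _).
by apply: eq_has => c'; rewrite /= cross_hmap.
Qed.

Lemma comps_rec_hmap f D :
  comps_rec f (map (hmap h) D) = map (map (hmap h)) (comps_rec f D).
Proof.
elim: f D => [|f IH] [|c D] //; rewrite map_cons !comps_recS map_cons -IH.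
have e : component (hmap h c :: map (hmap h) D) (hmap h c) =
         map (hmap h) (component (c :: D) c).
  by rewrite /component -grow_hmap /= size_map.
rewrite e; congr (_ :: comps_rec _ _).
rewrite -map_cons filter_map; congr map; apply: eq_filter => c' /=.
by rewrite (mem_map hmap_inj).
Qed.

Lemma comps_hmap D : comps (map (hmap h) D) = map (map (hmap h)) (comps D).
Proof. by rewrite /comps sortC_hmap size_map comps_rec_hmap. Qed.

Lemma iorder_hmap f D : iorder f (map (hmap h) D) = map (hmap h) (iorder f D).
Proof.
elim: f D => //= f IH D; rewrite sortC_hmap; case: (sortC D) => //= r R.
rewrite comps_hmap map_flatten -!map_comp; congr (_ :: flatten _).
by apply: eq_map => K /=.
Qed.

Lemma iord_hmap D : iord (map (hmap h) D) = map (hmap h) (iord D).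
Proof. by rewrite /iord size_map iorder_hmap. Qed.

Lemma norm_hmap D : norm (map (hmap h) D) = norm D.
Proof.
rewrite /norm -map_comp; apply: eq_map => c /=; rewrite /rankE endpoints_hmap !count_map.
by congr (_.+1, _.+1); apply: eq_count => x /=; rewrite (leqW_mono hM).
Qed.

Lemma conn_hmap D : conn (map (hmap h) D) <-> conn D.
Proof.
split=> cD X cl c c'.
  move=> c_D c'_D Xc.
  (* [X] is pushed forward to the image; injectivity of [hmap h] makes [Y] agree with [X] there. *)
  pose Y := [pred e | has (fun d => (hmap h d == e) && X d) D].
  have HY d : d \in D -> Y (hmap h d) = X d.
    move=> dD; apply/hasP/idP => [[d' d'D /andP[/eqP/hmap_inj -> //]]|Xd].
    by exists d; rewrite ?eqxx.
  have := cD Y _ (hmap h c) (hmap h c').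
  rewrite !HY // !(mem_map hmap_inj); apply=> //.
  move=> _ _ /mapP[a aD ->] /mapP[b bD ->]; rewrite cross_hmap !HY //; exact: cl.
move=> /mapP[a aD ->] /mapP[b bD ->]; apply: (cD (fun c => X (hmap h c))) => //.
by move=> x y xD yD xy; apply: cl; rewrite ?map_f ?cross_hmap.
Qed.

End Monotone.

(** * Normalized chord diagrams *)

(* Diagrams are represented by the sorted list of their chords. *)
Definition wf (D : seq chord) := [&& sorted lec D, all (fun c => c.1 < c.2) D &
  perm_eq (endpoints D) (iota 1 (size D).*2)].

Lemma perm_iota1 s : uniq s -> {in s, forall x, 0 < x <= size s} ->
  perm_eq s (iota 1 (size s)).
Proof.
move=> u H; have s_i : {subset s <= iota 1 (size s)}.
  by move=> x /H; rewrite mem_iota add1n ltnS.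
have := uniq_min_size u s_i; rewrite size_iota => /(_ (leqnn _))[_ e].
exact: uniq_perm (iota_uniq _ _) e.
Qed.

Lemma endpoints_fst_snd D : perm_eq (endpoints D) (map fst D ++ map snd D).
Proof.
elim: D => //= c D IH; rewrite /endpoints /= perm_cons.
apply: perm_trans (_ : perm_eq _ (c.2 :: map fst D ++ map snd D)) _; first by rewrite perm_cons.
by rewrite -cat_rcons -cats1 -cat_cons perm_cat2r cats1 -perm_rcons perm_refl.
Qed.

Lemma uniq_endpoints_fst D : uniq (endpoints D) -> uniq (map fst D).
Proof. by rewrite (perm_uniq (endpoints_fst_snd D)) cat_uniq => /andP[]. Qed.

Lemma mem_endpoints1 D (c : chord) : c \in D -> c.1 \in endpoints D.
Proof. by move=> cD; rewrite (perm_mem (endpoints_fst_snd D)) mem_cat map_f. Qed.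

Lemma mem_endpoints2 D (c : chord) : c \in D -> c.2 \in endpoints D.
Proof. by move=> cD; rewrite (perm_mem (endpoints_fst_snd D)) mem_cat orbC map_f. Qed.

Lemma endpointsP D x :
  reflect (exists2 c : chord, c \in D & x = c.1 \/ x = c.2) (x \in endpoints D).
Proof.
rewrite (perm_mem (endpoints_fst_snd D)) mem_cat; apply: (iffP orP).
  by case=> /mapP[c cD ->]; exists c => //; [left | right].
by case=> c cD [] ->; [left | right]; apply: map_f.
Qed.

Section Wf.
Variable D : seq chord.
Hypothesis wD : wf D.

Lemma wf_sorted : sorted lec D. Proof. by case/and3P: wD. Qed.

Lemma wf_lt (c : chord) : c \in D -> c.1 < c.2.
Proof. by case/and3P: wD => _ /allP H _ /H. Qed.

Lemma wf_perm : perm_eq (endpoints D) (iota 1 (size D).*2).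
Proof. by case/and3P: wD. Qed.

Lemma wf_uniq_endpoints : uniq (endpoints D).
Proof. by rewrite (perm_uniq wf_perm) iota_uniq. Qed.

Lemma wf_uniq_fst : uniq (map fst D).
Proof. exact: uniq_endpoints_fst wf_uniq_endpoints. Qed.

Lemma wf_uniq : uniq D. Proof. exact: map_uniq wf_uniq_fst. Qed.

Lemma wf_mem_endpoints x : (x \in endpoints D) = (0 < x <= (size D).*2).
Proof. by rewrite (perm_mem wf_perm) mem_iota add1n ltnS. Qed.

Lemma wf_bounds (c : chord) : c \in D -> [/\ 0 < c.1, c.1 < c.2 & c.2 <= (size D).*2].
Proof.
move=> cD; have := mem_endpoints1 cD; have := mem_endpoints2 cD.
by rewrite !wf_mem_endpoints => /andP[_ ->] /andP[-> _]; rewrite wf_lt.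
Qed.

Lemma norm_wf : norm D = D.
Proof.
have H x : 0 < x <= (size D).*2 -> rankE D x = x.
  move=> /andP[x0 xD]; rewrite /rankE; case/and3P: wD => _ _ /seq.permP ->.
  rewrite -size_filter -[RHS](prednK x0); congr _.+1.
  rewrite -[RHS](size_iota 1); apply/perm_size/uniq_perm; rewrite ?filter_uniq ?iota_uniq //.
  move=> y; rewrite mem_filter !mem_iota; lia.
have Hc (c : chord) : c \in D -> (rankE D c.1, rankE D c.2) = c.
  move=> /wf_bounds[c0 c12 c2].
  by rewrite !H; [case: (c) | rewrite (ltn_trans c0 c12) | rewrite c0 (leq_trans (ltnW c12))].
by rewrite /norm -[RHS]map_id; apply/eq_in_map => c /Hc.
Qed.

End Wf.

(** The endpoint 1 must be a left endpoint, and the head of a sorted list has the smallest one. *)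
Lemma wf_root r D : wf (r :: D) -> r.1 = 1.
Proof.
move=> w; have : 1 \in endpoints (r :: D) by rewrite (wf_mem_endpoints w).
case/endpointsP => c cD e.
have [c0 c12 _] := wf_bounds w cD.
have {e c12} c1 : c.1 = 1 by case: e => e; lia.
have [r0 _ _] := wf_bounds w (mem_head r D).
have : lec r c.
  have /= := wf_sorted w; rewrite (path_sortedE lec_trans) => /andP[/allP H _].
  by move: cD; rewrite inE => /orP[/eqP ->|/H //]; apply: leqnn.
rewrite /lec c1; lia.
Qed.

Lemma wf_tail_gt1 r D (c : chord) : wf (r :: D) -> c \in D -> 1 < c.1.
Proof.
move=> w cD; have [c0 _ _] : [/\ 0 < c.1, c.1 < c.2 & c.2 <= (size (r :: D)).*2].
  by apply: wf_bounds => //; rewrite inE cD orbT.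
have := wf_uniq_fst w; rewrite /= (wf_root w) => /andP[n1 _].
by rewrite ltn_neqAle c0 andbT; apply: contra n1 => /eqP ->; apply: map_f.
Qed.

(** * Insertion *)

(** The shifts of [insertCD] rewritten as functions of the endpoint alone. Only the root's left end
    1 is fixed by [hL]; 0 is fixed too, which keeps the map strictly increasing on all naturals. *)
Definition hL (k x : nat) := if x <= 1 then x else x + k.
Definition hR (n k x : nat) := if x <= k then x.+1 else x + n.*2.

Lemma hL_mono k : {mono hL k : x y / x <= y}.
Proof. by move=> x y; rewrite /hL; case: (leqP x 1); case: (leqP y 1); lia. Qed.

Lemma hR_mono n k : 0 < n -> {mono hR n k : x y / x <= y}.
Proof. by move=> n0 x y; rewrite /hR; case: (leqP x k); case: (leqP y k); lia. Qed.

Definition gL k := hmap (hL k).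
Definition gR n k := hmap (hR n k).

Lemma insertCD_hmap C k D : wf C ->
  insertCD C k D = map (gL k) C ++ map (gR (size C) k) D.
Proof.
move=> w; have H (c : chord) : c \in C ->
    (if c.1 == 1 then (1, c.2 + k) else (c.1 + k, c.2 + k)) = gL k c.
  move=> cC; have [c0 c12 _] := wf_bounds w cC.
  rewrite /gL /hmap /hL (leqNgt c.2) (leq_ltn_trans c0 c12) /=.
  by case: eqP => [-> //|c1]; rewrite leqNgt ltn_neqAle c0 andbT eq_sym; move/eqP: c1 => ->.
by congr cat; apply/eq_in_map => c /H.
Qed.

(** Sorting selects the canonical list of the inserted diagram, so that equality of diagrams is
    equality of lists. *)
Definition insertS C k D := sortC (insertCD C k D).

Lemma perm_endpoints_uniq_fst D E : perm_eq D E -> uniq (endpoints E) -> uniq (map fst D).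
Proof. by move=> p u; apply: uniq_endpoints_fst; rewrite (perm_uniq (perm_endpoints p)). Qed.

Lemma iorder_fuel f C : size C <= f -> iorder f C = iord C.
Proof.
have [m] := ubnP (size C); elim: m f C => // m IH [|f] C lt le.
  by move: le; rewrite leqn0 size_eq0 => /eqP ->.
rewrite /iord; case eC: (size C) => [|n]; first by case: (C) eC.
have := size_sortC C; rewrite /=; case: (sortC C) => // r R sR.
congr (_ :: flatten _); apply/eq_in_map => K /size_comps KR.
have KC : size K < size C by rewrite -sR ltnS.
have Km : size K < m by apply: leq_trans KC _.
rewrite (IH f K Km) ?(IH n K Km) //; rewrite -ltnS; first by rewrite -eC.
exact: leq_trans KC le.
Qed.

Lemma iord_cons r R C : sortC C = r :: R -> iord C = r :: flatten (map iord (comps R)).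
Proof.
move=> eC; have := size_sortC C; rewrite eC /iord => <- /=; rewrite eC.
by congr (_ :: flatten _); apply/eq_in_map => K /size_comps; apply: iorder_fuel.
Qed.

Section Insert.
Variables (r : chord) (C0 D : seq chord) (k : nat).
Hypotheses (wC : wf (r :: C0)) (wD : wf D) (k0 : 0 < k) (kD : k < (size D).*2).
Let C := r :: C0.
Let n := size C.
Let n0 : 0 < n. Proof. by []. Qed.
Let hLM := hL_mono k.
Let hRM := @hR_mono n k n0.

(** Endpoints of [C] land on 1 and on the block from [k + 2] to [k + 2n]; those of [D] land on 2,
    ..., [k + 1] and beyond [k + 2n]. The images are disjoint and lie in the right range, so
    counting finishes. *)
Lemma insertCD_endpoints :
  perm_eq (endpoints (insertCD C k D)) (iota 1 (size C + size D).*2).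
Proof.
rewrite insertCD_hmap // endpoints_cat !endpoints_hmap.
set s := _ ++ _.
have -> : (size C + size D).*2 = size s.
  by rewrite size_cat !size_map !size_endpoints doubleD.
have ss : size s = (size C + size D).*2.
  by rewrite size_cat !size_map !size_endpoints doubleD.
apply: perm_iota1.
  rewrite cat_uniq !(map_inj_uniq (incn_inj hLM)) !(map_inj_uniq (incn_inj hRM)).
  rewrite !wf_uniq_endpoints // andbT; apply/hasPn => x /mapP[y].
  rewrite (wf_mem_endpoints wD) => yD ->; apply/mapP => -[z].
  rewrite (wf_mem_endpoints wC) /hL /hR -/C -/n; case: (leqP z 1); case: (leqP y k); lia.
move=> x; rewrite ss mem_cat => /orP[] /mapP[y].
  rewrite (wf_mem_endpoints wC) /hL -/C -/n => ? ->; case: (leqP y 1); lia.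
rewrite (wf_mem_endpoints wD) /hR -/C -/n => ? ->; case: (leqP y k); lia.
Qed.

Lemma insertS_perm : perm_eq (insertS C k D) (map (gL k) C ++ map (gR n k) D).
Proof. by rewrite -insertCD_hmap //; apply: perm_sortC. Qed.

Lemma size_insertS : size (insertS C k D) = size C + size D.
Proof. by rewrite (perm_size insertS_perm) size_cat !size_map. Qed.

Lemma insertS_wf : wf (insertS C k D).
Proof.
apply/and3P; split; first exact: sortC_sorted.
  apply/allP => c; rewrite (perm_mem insertS_perm) mem_cat.
  case/orP=> /mapP[d dD ->] /=; rewrite (leqW_mono hLM, leqW_mono hRM);
  [exact: (wf_lt wC) | exact: (wf_lt wD)].
rewrite size_insertS; apply: perm_trans insertCD_endpoints.
by apply: perm_endpoints; apply: perm_sortC.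
Qed.

Lemma gL_root : gL k r = (1, r.2 + k).
Proof.
have [_ r12 _] := wf_bounds wC (mem_head _ _).
move: r12; rewrite /gL /hmap (wf_root wC) /hL /=; case: leqP => //; lia.
Qed.

Definition insert_rest := sortC (map (gL k) C0 ++ map (gR n k) D).

Lemma insert_rest_perm : perm_eq insert_rest (map (gL k) C0 ++ map (gR n k) D).
Proof. exact: perm_sortC. Qed.

Lemma uniq_insert_rest : uniq (map fst insert_rest).
Proof.
have u := wf_uniq_endpoints insertS_wf.
rewrite (perm_uniq (perm_endpoints insertS_perm)) [map _ C]/= cat_cons in u.
have {}u : uniq (endpoints (map (gL k) C0 ++ map (gR n k) D)).
  by move: u; rewrite /endpoints /= => /and3P[].
exact: perm_endpoints_uniq_fst insert_rest_perm u.
Qed.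

Lemma insertS_cons : insertS C k D = gL k r :: insert_rest.
Proof.
have p : perm_eq (insertCD C k D) (gL k r :: insert_rest).
  rewrite insertCD_hmap // [map _ C]/= cat_cons perm_cons perm_sym.
  exact: insert_rest_perm.
apply: sortC_eq => //.
  by apply: perm_endpoints_uniq_fst (perm_refl _) _; rewrite (perm_uniq insertCD_endpoints) iota_uniq.
rewrite /= (path_sortedE lec_trans) sortC_sorted andbT; apply/allP => c cR.
have cI : c \in insertS C k D by rewrite mem_sortC (perm_mem p) inE cR orbT.
by have [? _ _] := wf_bounds insertS_wf cI; rewrite /lec gL_root.
Qed.

(** Both ends of a chord of [C0] lie in the block [k + 2], ..., [k + 2n], which contains no endpoint
    coming from [D]. *)
Lemma cross_gL_gR (c d : chord) : c \in C0 -> d \in D -> cross (gL k c) (gR n k d) = false.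
Proof.
move=> cC dD; have c1 := wf_tail_gt1 wC cC.
have [|_ c12 c2] := @wf_bounds _ wC c; first by rewrite inE cC orbT.
have [d0 d12 d2] := wf_bounds wD dD; move: c2; rewrite -/C -/n => c2.
rewrite /cross /gL /gR /hmap /hL /hR /=.
by case: (leqP c.1 1); case: (leqP c.2 1); case: (leqP d.1 k); case: (leqP d.2 k); lia.
Qed.

(** The root runs from 1 into that same block, so it crosses exactly the chords of [D] with one end
    on each side of the cut [k]. *)
Lemma cross_root_gR (d : chord) : d \in D -> cross (gL k r) (gR n k d) = (d.1 <= k < d.2).
Proof.
move=> dD; have [_ _ r2] := wf_bounds wC (mem_head _ _).
have [d0 d12 d2] := wf_bounds wD dD; move: r2; rewrite -/C -/n => c2.
have [_ r12 _] := wf_bounds wC (mem_head _ _); rewrite (wf_root wC) in r12.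
rewrite gL_root /cross /gR /hmap /hR /=.
by case: (leqP d.1 k); case: (leqP d.2 k); lia.
Qed.

Lemma mem_insert_rest c : c \in insert_rest ->
  (c \in map (gL k) C0) = (c \notin map (gR n k) D).
Proof.
have := map_uniq uniq_insert_rest.
rewrite (perm_uniq insert_rest_perm) (perm_mem insert_rest_perm) cat_uniq mem_cat.
case/and3P=> _ /hasPn H _; case/orP => cI; first by rewrite cI; apply/esym; apply: contraL cI => /H.
by rewrite cI (negPf (H _ cI)).
Qed.

Lemma filter_insert_restR : [seq c <- insert_rest | c \in map (gR n k) D] = map (gR n k) D.
Proof.
rewrite -sortC_filter filter_cat.
rewrite (_ : filter _ (map _ C0) = [::]); last first.
  apply/eqP; rewrite -size_eq0 size_filter -leqn0 leqNgt -has_count; apply/hasPn => c cI.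
  by rewrite -mem_insert_rest // (perm_mem insert_rest_perm) mem_cat cI.
rewrite (_ : filter _ _ = map (gR n k) D); last by apply/all_filterP/allP.
by rewrite sorted_sortC // sorted_hmap // wf_sorted.
Qed.

Lemma filter_insert_restL :
  [seq c <- insert_rest | c \notin map (gR n k) D] = map (gL k) C0.
Proof.
rewrite -sortC_filter filter_cat [X in _ ++ X](_ : _ = [::]); last first.
  apply/eqP; rewrite -size_eq0 size_filter -leqn0 leqNgt -has_count; apply/hasPn => c cI.
  by rewrite negbK.
rewrite (_ : filter _ _ = map (gL k) C0) ?cats0; last first.
  apply/all_filterP/allP => c cI.
  by rewrite -mem_insert_rest // (perm_mem insert_rest_perm) mem_cat cI.
by rewrite sorted_sortC // sorted_hmap //; apply: path_sorted (wf_sorted wC).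
Qed.

(** The image of [D] is connected, crosses nothing from [C0], and contains the smallest endpoint: 1
    in [D] becomes 2, while left endpoints coming from [C0] are at least 3. Hence it is the first
    component. *)
Lemma comps_insert_rest : conn D ->
  comps insert_rest = map (gR n k) D :: comps (map (gL k) C0).
Proof.
move=> cD; have uR := map_uniq uniq_insert_rest.
have sR : sorted lec insert_rest by apply: sortC_sorted.
have : 0 < size D by case: (D) kD.
case: {-1}D (erefl D) => [|d D0] // eD _.
have dD : d \in D by rewrite eD mem_head.
have := wf_root (D := D0) (r := d); rewrite -eD => /(_ wD) d1.
have gd : gR n k d \in insert_rest.
  by rewrite (perm_mem insert_rest_perm) mem_cat map_f ?orbT.
case eR: insert_rest gd => [|c R] // gd; rewrite -eR in gd *.
have cR : c \in insert_rest by rewrite eR mem_head.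
have cX : c \in map (gR n k) D.
  have le : c.1 <= 2.
    have : lec c (gR n k d).
      move: sR gd; rewrite eR /= (path_sortedE lec_trans) inE => /andP[/allP H _].
      by case/orP=> [/eqP <-|/H //]; apply: leqnn.
    by rewrite /lec /= d1 /hR k0.
  apply: contraTT cR => nX; rewrite (perm_mem insert_rest_perm) mem_cat (negPf nX) orbF.
  apply/mapP => -[e eC ce]; have := wf_tail_gt1 wC eC.
  move: le; rewrite ce /= /hL; case: leqP; lia.
have K : component insert_rest c = map (gR n k) D.
  rewrite (component_eq (X := [in map (gR n k) D]) uR cR) //.
  - exact: filter_insert_restR.
  - move=> a b aR bR ab aX; apply/negPn/negP => /=; rewrite -mem_insert_rest // => bL.
    case/mapP: aX ab => x xD ->; case/mapP: bL => y yC ->.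
    by rewrite crossC cross_gL_gR.
  move=> Y clY Yc e eR' eX.
  have/(conn_hmap hRM) cD' := cD.
  apply: (cD' Y) cX eX Yc => a b aX bX; apply: clY.
    by rewrite (perm_mem insert_rest_perm) mem_cat aX orbT.
  by rewrite (perm_mem insert_rest_perm) mem_cat bX orbT.
rewrite eR in K sR *; rewrite comps_cons // K -eR; congr (_ :: comps _).
exact: filter_insert_restL.
Qed.

Lemma iord_insertS : conn D ->
  iord (insertS C k D) = gL k r :: map (gR n k) (iord D) ++ map (gL k) (behead (iord C)).
Proof.
move=> cD; rewrite (iord_cons (sorted_sortC (wf_sorted wC))).
have sI : sortC (insertS C k D) = gL k r :: insert_rest.
  by rewrite sorted_sortC ?sortC_sorted // insertS_cons.
rewrite (iord_cons sI) comps_insert_rest //= iord_hmap // comps_hmap //.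
rewrite map_flatten -!map_comp; congr (_ :: _ ++ flatten _).
by apply: eq_map => K /=; rewrite iord_hmap.
Qed.

End Insert.

(** * The root share decomposition *)

Lemma wf_neq_endpoints D (c d : chord) : wf D -> c \in D -> d \in D -> c != d ->
  [/\ c.1 <> d.1, c.1 <> d.2, c.2 <> d.1 & c.2 <> d.2].
Proof.
move=> wD cD dD ne; have u := wf_uniq_endpoints wD.
have p : perm_eq (c :: d :: rem d (rem c D)) D.
  have dr : d \in rem c D by rewrite mem_rem_uniq ?wf_uniq // !inE eq_sym ne.
  by rewrite perm_sym (perm_trans (perm_to_rem cD)) // perm_cons perm_to_rem.
have := perm_endpoints p; move/perm_uniq; rewrite u /endpoints /= !inE => /and5P[].
rewrite !negb_or => /and4P[_ /eqP ? /eqP ? _] /and3P[/eqP ? /eqP ? _] _ _ _.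
by split.
Qed.

(** Here [Z] will be the endpoints of [C'] except 1, [E] those of [C''], and [y] the right end of
    the root. Since no element of [E] separates two elements of [Z], the set [Z] is an interval,
    preceded by 1 and the [k] elements of [E] below [y]. Each bound compares the cardinality of an
    initial segment with that of [A] or [A ++ Z]. *)
Lemma gap_ranges M (E Z : seq nat) y : perm_eq (1 :: Z ++ E) (iota 1 M) -> y \in Z ->
  (forall z x, z \in Z -> x \in E -> (x < z) = (x < y)) ->
  let k := count (fun x => x < y) E in
  [/\ forall x, x \in E -> x < y -> 1 < x <= k.+1,
      forall z, z \in Z -> k.+1 < z <= k.+1 + size Z &
      forall x, x \in E -> y <= x -> k.+1 + size Z < x].
Proof.
move=> p yZ H k.
have u : uniq (1 :: Z ++ E) by rewrite (perm_uniq p) iota_uniq.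
have sz : size (1 :: Z ++ E) = M by rewrite (perm_size p) size_iota.
have mem x : (x \in 1 :: Z ++ E) = (0 < x <= M) by rewrite (perm_mem p) mem_iota add1n ltnS.
pose A := 1 :: [seq x <- E | x < y].
have sA : size A = k.+1 by rewrite /= size_filter.
move: (u); rewrite /= mem_cat negb_or cat_uniq => /andP[/andP[Z1 E1] /and3P[uZ /hasPn ZE uE]].
have uA : uniq A by rewrite /= mem_filter (negPf E1) andbF filter_uniq.
have uAZ : uniq (A ++ Z).
  rewrite cat_uniq uA uZ andbT; apply/hasPn => z zZ; rewrite inE mem_filter !negb_or.
  by rewrite (contraTneq _ zZ) => [|->//]; apply: contraL zZ => /andP[_ /ZE].
have gt1 x : x \in Z ++ E -> 1 < x.
  move=> xs; have : x \in 1 :: Z ++ E by rewrite inE xs orbT.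
  have : x <> 1 by move=> x1; move: xs; rewrite x1 mem_cat (negPf Z1) (negPf E1).
  by rewrite mem; clear; lia.
have leM x : x \in Z ++ E -> x <= M.
  move=> xs; have : x \in 1 :: Z ++ E by rewrite inE xs orbT.
  by rewrite mem => /andP[].
have inM x v : v \in Z ++ E -> x \in iota 1 v -> x \in 1 :: Z ++ E.
  by move=> /leM; rewrite mem mem_iota; clear; lia.
have neZE z x : z \in Z -> x \in E -> z <> x.
  by move=> zZ xE zx; have := ZE _ xE; rewrite /= -zx zZ.
have gtZ z : z \in Z -> 1 < z by move=> zZ; rewrite gt1 // mem_cat zZ.
have gtE x : x \in E -> 1 < x by move=> xE; rewrite gt1 // mem_cat xE orbT.
split.
- move=> x xE xy; rewrite gtE //= -sA -[leqLHS](size_iota 1).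
  apply: uniq_leq_size (iota_uniq _ _) _ => t tx.
  have := inM t x; rewrite mem_cat xE orbT => /(_ isT tx).
  rewrite mem_iota in tx; rewrite !inE mem_cat mem_filter => /orP[-> //|/orP[tZ|tE]].
    by have := neZE _ _ tZ xE; have := H _ _ tZ xE; move: xy tx; clear; lia.
  by rewrite tE andbT; apply/orP; right; move: xy tx; clear; lia.
- move=> z zZ; apply/andP; split.
    rewrite -sA -[z]prednK ?ltnS; last exact: ltnW (gtZ z zZ).
    rewrite -[leqRHS](size_iota 1); apply: uniq_leq_size uA _ => t.
    rewrite inE mem_filter => /orP[/eqP ->|/andP[ty tE]].
      by rewrite mem_iota; move: (gtZ z zZ); clear; lia.
    have := H _ _ zZ tE; rewrite ty mem_iota.
    by move: (gtZ z zZ) (gtE t tE); clear; lia.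
  rewrite -sA -size_cat -[leqLHS](size_iota 1); apply: uniq_leq_size (iota_uniq _ _) _ => t tz.
  have := inM t z; rewrite mem_cat zZ => /(_ isT tz).
  rewrite mem_iota in tz; rewrite /A !(mem_cat, inE) mem_filter => /orP[-> //|/orP[->|tE]].
    by rewrite !orbT.
  by have := neZE _ _ zZ tE; have := H _ _ zZ tE; rewrite tE; move: tz; clear; lia.
move=> x xE yx; rewrite -sA -size_cat -[x]prednK ?ltnS; last exact: ltnW (gtE x xE).
rewrite -[leqRHS](size_iota 1); apply: uniq_leq_size uAZ _ => t tA.
suff : 0 < t < x by rewrite mem_iota; move: (gtE x xE); clear; lia.
move: tA; rewrite mem_cat inE mem_filter => /orP[/orP[/eqP ->|/andP[ty tE]]|tZ].
- by rewrite gtE.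
- by rewrite (leq_trans ty yx) andbT ltnW // gtE.
by have := neZE _ _ tZ xE; have := H _ _ tZ xE; move: (gtZ t tZ) yx; clear; lia.
Qed.

Lemma component_sorted D c : sorted lec D -> c \in D -> sorted lec (component D c).
Proof. by move=> sD cD; rewrite component_filter // (sorted_filter lec_trans). Qed.

Section Decompose.
Variables (r : chord) (R : seq chord).
Let I := r :: R.
Hypotheses (wI : wf I) (cI : conn I) (R0 : R != [::]).

Let e := head (0, 0) R.
Let C1 := component R e.
Let Cp := [seq c <- R | c \notin C1].
Let y := r.2.

Let eR : e \in R. Proof. by rewrite /e; case: (R) R0 => //= a s _; apply: mem_head. Qed.
Let uI : uniq I. Proof. exact: wf_uniq wI. Qed.
Let uR : uniq R. Proof. by case/andP: uI. Qed.
Let sR : sorted lec R. Proof. exact: path_sorted (wf_sorted wI). Qed.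
Let RI (c : chord) : c \in R -> c \in I. Proof. by rewrite inE orbC => ->. Qed.
Let C1R (c : chord) : c \in C1 -> c \in R. Proof. exact: component_sub. Qed.
Let CpR (c : chord) : c \in Cp -> c \in R. Proof. by rewrite mem_filter => /andP[]. Qed.
Let rR : r \notin R. Proof. by case/andP: uI. Qed.

Lemma cross_C1_Cp (c q : chord) : c \in C1 -> q \in Cp -> cross c q = false.
Proof.
move=> c1 qp; apply/negP => cq.
have := component_closed uR eR (C1R c1) (CpR qp) cq c1.
by move: qp; rewrite mem_filter => /andP[/negP].
Qed.

Lemma neq_C1_Cp (c q : chord) : c \in C1 -> q \in Cp ->
  [/\ c.1 <> q.1, c.1 <> q.2, c.2 <> q.1 & c.2 <> q.2].
Proof.
move=> c1 qp; apply: (wf_neq_endpoints wI (RI (C1R c1)) (RI (CpR qp))).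
by apply/eqP => cq; move: qp; rewrite -cq /Cp mem_filter c1.
Qed.

(** The smallest endpoint [e.1] is not under [q], and a crossing inside [C1] cannot lead from
    outside [q] to under [q] without crossing [q]. *)
Lemma C1_outside (c q : chord) : c \in C1 -> q \in Cp ->
  ~~ (q.1 < c.1 < q.2) /\ ~~ (q.1 < c.2 < q.2).
Proof.
move=> c1 qp.
have eC1 : e \in C1 by apply: mem_component.
have le : e.1 <= q.1.
  move: sR (CpR qp); rewrite /e; case: (R) => //= a s.
  rewrite (path_sortedE lec_trans) inE => /andP[/allP H _] /orP[/eqP -> //|/H //].
have /andP[_ co] : (c \in C1) && ~~ (q.1 < c.1 < q.2).
  apply: (@component_min R e (fun c : chord => (c \in C1) && ~~ (q.1 < c.1 < q.2)) eR _ _ c c1).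
    move=> a b aR bR ab /andP[aC1 ao].
    have bC1 : b \in C1 by apply: (component_closed uR eR aR bR ab).
    rewrite bC1 /=.
    have := cross_C1_Cp aC1 qp; have := cross_C1_Cp bC1 qp.
    have [] := neq_C1_Cp aC1 qp; have [] := neq_C1_Cp bC1 qp.
    have := wf_lt wI (RI aR); have := wf_lt wI (RI bR); have := wf_lt wI (RI (CpR qp)).
    by move: ao ab; rewrite /cross; clear; lia.
  by rewrite eC1 /= ltnNge le.
have := cross_C1_Cp c1 qp; have [] := neq_C1_Cp c1 qp.
have := wf_lt wI (RI (C1R c1)); have := wf_lt wI (RI (CpR qp)).
by move: co; rewrite /cross; clear; lia.
Qed.

Let r1 : r.1 = 1. Proof. exact: wf_root wI. Qed.

Lemma C1_root (f : chord) : f \in C1 -> cross f r = (f.1 < y < f.2).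
Proof.
move=> fC1; have := wf_tail_gt1 wI (C1R fC1); have := wf_lt wI (mem_head r R).
by rewrite /cross r1 -/y; clear; lia.
Qed.

Lemma C1_cross_root : exists2 f : chord, f \in C1 & f.1 < y < f.2.
Proof.
suff /hasP[f fC1 fr] : has (fun f => cross f r) C1 by exists f; rewrite -?C1_root.
apply/hasPn => nr; have cl : cross_closed I [in C1].
  move=> a b aI bI ab aC1; have aR := C1R aC1.
  case: (eqVneq b r) => [br|nbr]; first by move: ab (nr a aC1); rewrite br => ->.
  have bR : b \in R by move: bI; rewrite inE (negPf nbr).
  exact: (component_closed uR eR aR bR ab).
have := cI cl (RI eR) (mem_head r R) (mem_component eR).
by move/C1R; apply/negP.
Qed.

(** The gap of [C1] containing [y] is propagated along crossings from the root: a chord of [Cp]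
    covers no endpoint of [C1], so crossing it never changes the gap. *)
Lemma root_gap (q x : chord) : q \in Cp -> x \in C1 ->
  (x.1 < q.1) = (x.1 < y) /\ (x.2 < q.1) = (x.2 < y).
Proof.
(* Declaring [X] true on [C1] and on the root leaves only crossings that arrive at a chord of [Cp]
   to be checked. *)
pose X (q : chord) := [|| q \in C1, q == r |
   all (fun x : chord => ((x.1 < q.1) == (x.1 < y)) && ((x.2 < q.1) == (x.2 < y))) C1].
have cl : cross_closed I X.
  move=> a b aI bI ab; rewrite /X.
  case: (boolP (b \in C1)) => //= bC1; case: (eqVneq b r) => //= nbr.
  have bR : b \in R by move: bI; rewrite inE (negPf nbr).
  have bp : b \in Cp by rewrite mem_filter bC1.
  case/or3P => [aC1|/eqP ar|/allP H].
  - by move: ab; rewrite cross_C1_Cp.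
  - apply/allP => t tC1; have [o1 o2] := C1_outside tC1 bp.
    have [n1 n2 n3 n4] := neq_C1_Cp tC1 bp.
    have := wf_tail_gt1 wI bR; have := wf_lt wI (RI bR).
    by move: ab o1 o2 n1 n2 n3 n4; rewrite ar /cross r1 -/y; clear; lia.
  case: (eqVneq a r) => [ar|nar].
    apply/allP => t tC1; have [o1 o2] := C1_outside tC1 bp.
    have [n1 n2 n3 n4] := neq_C1_Cp tC1 bp.
    have := wf_tail_gt1 wI bR; have := wf_lt wI (RI bR).
    by move: ab o1 o2 n1 n2 n3 n4; rewrite ar /cross r1 -/y; clear; lia.
  have aR : a \in R by move: aI; rewrite inE (negPf nar).
  case: (boolP (a \in C1)) => [aC1|aC1]; first by move: ab; rewrite cross_C1_Cp.
  have ap : a \in Cp by rewrite mem_filter aC1.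
  apply/allP => t tC1; have := H t tC1.
  have [] := C1_outside tC1 bp; have [] := C1_outside tC1 ap.
  have [] := neq_C1_Cp tC1 bp; have [] := neq_C1_Cp tC1 ap.
  have := wf_lt wI (RI bR); have := wf_lt wI (RI aR).
  by move: ab; rewrite /cross; clear; lia.
move=> qp xC1; have qI := RI (CpR qp).
have := cI cl (mem_head r R) qI; rewrite /X eqxx orbT => /(_ isT) /or3P[qC1|/eqP qr|/allP H].
- by move: qp; rewrite mem_filter qC1.
- by move: (CpR qp) rR; rewrite qr => ->.
by have /andP[/eqP -> /eqP ->] := H x xC1.
Qed.

Let Z := y :: endpoints Cp.
Let E1 := endpoints C1.
Let k := count (fun x => x < y) E1.

Lemma decompose_perm : perm_eq (r :: Cp ++ C1) I.
Proof.
rewrite perm_cons; apply: perm_trans (permEl (perm_filterC [in C1] R)).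
by rewrite perm_catC {1}/C1 [component R e]component_filter.
Qed.

Lemma decompose_ranges :
  [/\ forall x, x \in E1 -> x < y -> 1 < x <= k.+1,
      forall z, z \in Z -> k.+1 < z <= k.+1 + size Z &
      forall x, x \in E1 -> y <= x -> k.+1 + size Z < x].
Proof.
apply: (@gap_ranges (size I).*2); rewrite ?mem_head //.
  apply: perm_trans (wf_perm wI); apply: perm_trans (perm_endpoints decompose_perm).
  by rewrite -[r :: Cp ++ C1]cat_cons endpoints_cat /endpoints /= -/(endpoints _) r1.
move=> z x; rewrite inE => /orP[/eqP -> //|/endpointsP[q qp zq]] /endpointsP[f fC1 xf].
have [g1 g2] := root_gap qp fC1.
have [o1 o2] := C1_outside fC1 qp; have [n1 n2 n3 n4] := neq_C1_Cp fC1 qp.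
have := wf_lt wI (RI (CpR qp)).
by case: zq => ->; case: xf => ->; rewrite -?g1 -?g2 //; move: o1 o2 n1 n2 n3 n4; clear; lia.
Qed.

Lemma size_Z : size Z = (size (r :: Cp)).*2.-1.
Proof. by rewrite /= size_endpoints. Qed.

(** The cut is the number of endpoints of [C1] to the left of the root's right end. *)
Lemma decompose_insertS : exists r' C0 D k', [/\ wf (r' :: C0), conn (r' :: C0), wf D, conn D &
  [/\ 0 < k', k' < (size D).*2 & I = insertS (r' :: C0) k' D]].
Proof.
have [HE1 HZ HE2] := decompose_ranges; rewrite size_Z in HZ HE2.
have [n eqn] : exists n, n = size (r :: Cp) by exists (size (r :: Cp)).
have n0 : 0 < n by rewrite eqn.
rewrite -eqn in HZ HE2.
(* Left inverses of the two shifts, with the thresholds read off from [decompose_ranges]; [KL] and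
   [KR] say that shifting back restores the endpoints that occur. *)
pose hLi x := if x <= 1 then x else x - k.
pose hRi x := if x <= k.+1 then x.-1 else x - n.*2.
pose C' := map (hmap hLi) (r :: Cp); pose D := map (hmap hRi) C1.
have hLM := hL_mono k; have hRM := @hR_mono n k n0.
have KL x : x \in endpoints (r :: Cp) -> hL k (hLi x) = x.
  rewrite /endpoints /= -/(endpoints _) inE r1 => /orP[/eqP -> //|/HZ xZ].
  rewrite /hL /hLi; have -> : (x <= 1) = false by move: xZ; clear; lia.
  by move: xZ; case: (leqP (x - k) 1); clear; lia.
have KR x : x \in E1 -> hR n k (hRi x) = x.
  move=> xE; rewrite /hR /hRi; case: (ltnP x y) => xy.
    by have /andP[x1 xk] := HE1 _ xE xy; rewrite xk; move: x1 xk; case: (leqP x.-1 k); clear; lia.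
  have xk := HE2 _ xE xy.
  have -> : (x <= k.+1) = false by move: xk n0; clear; lia.
  by move: xk n0; case: (leqP (x - n.*2) k); clear; lia.
have eC : map (gL k) C' = r :: Cp.
  rewrite /C' -map_comp -[RHS]map_id; apply/eq_in_map => c cC.
  rewrite /gL /hmap /= !KL ?mem_endpoints1 ?mem_endpoints2 //; by case: (c).
have eD : map (gR n k) D = C1.
  rewrite /D -map_comp -[RHS]map_id; apply/eq_in_map => c cC.
  rewrite /gR /hmap /= !KR ?mem_endpoints1 ?mem_endpoints2 //; by case: (c).
have sC' : size C' = n by rewrite size_map eqn.
have uIe := wf_uniq_endpoints wI.
have p : perm_eq ((r :: Cp) ++ C1) I := decompose_perm.
have := uIe; rewrite -(perm_uniq (perm_endpoints p)) endpoints_cat cat_uniq => /and3P[uC _ uD].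
have sI : size I = n + size C1 by rewrite -(perm_size p) size_cat eqn.
have sub1 (c : chord) : c \in r :: Cp -> c \in I.
  by move=> cC; rewrite -(perm_mem p) mem_cat cC.
have wC : wf C'.
  apply/and3P; split.
  - rewrite -(sorted_hmap hLM) -/(gL k) eC.
    have := sorted_filter lec_trans (fun c => c \notin C1) (wf_sorted wI).
    rewrite /= ifT //; by apply: contra rR => /C1R.
  - apply/allP => c cC; have : gL k c \in r :: Cp by rewrite -eC map_f.
    by move/sub1/(wf_lt wI); rewrite /= (leqW_mono hLM).
  - rewrite -size_endpoints; apply: perm_iota1.
      by rewrite -(map_inj_uniq (incn_inj hLM)) -endpoints_hmap -/(gL k) eC.
    move=> x xC; have : hL k x \in endpoints (r :: Cp).
      by rewrite -eC endpoints_hmap map_f.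
    rewrite size_endpoints sC' /endpoints /= -/(endpoints _) inE r1 => /orP[|/HZ].
      by rewrite /hL; move: n0; case: (leqP x 1); clear; lia.
    by rewrite /hL; move: n0; case: (leqP x 1); clear; lia.
have wD : wf D.
  apply/and3P; split.
  - have := sorted_hmap hRM D; rewrite -/(gR n k) eD => <-.
    exact: component_sorted sR eR.
  - apply/allP => c cC; have : gR n k c \in C1 by rewrite -eD map_f.
    by move/C1R/RI/(wf_lt wI); rewrite /= (leqW_mono hRM).
  - rewrite -size_endpoints; apply: perm_iota1.
      by rewrite -(map_inj_uniq (incn_inj hRM)) -endpoints_hmap -/(gR n k) eD.
    move=> x xC; have xE : hR n k x \in E1 by rewrite /E1 -eD endpoints_hmap map_f.
    have : hR n k x \in endpoints I.
      by rewrite -(perm_mem (perm_endpoints p)) endpoints_cat mem_cat xE orbT.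
    rewrite (wf_mem_endpoints wI) sI size_endpoints size_map => /andP[_ le].
    case: (ltnP (hR n k x) y) => xy.
      have kE : k <= size E1 by apply: count_size.
      rewrite size_endpoints in kE.
      by have := HE1 _ xE xy; move: le n0 kE; rewrite /hR; case: (leqP x k); clear; lia.
    by have := HE2 _ xE xy; move: le n0; rewrite /hR; case: (leqP x k); clear; lia.
have cCp : conn (r :: Cp).
  apply: (conn_from (mem_head r Cp)) => X cl Xr c cC.
  (* Among the remaining chords [C1] meets only the root, where [X] holds; so [X] stays
     crossing-closed on [I] after being declared true on [C1]. *)
  pose X' c := (c \in C1) || X c.
  have cl' : cross_closed I X'.
    move=> a b aI bI ab; rewrite /X'.
    case: (boolP (b \in C1)) => //= bC1.
    have bC : b \in r :: Cp by move: bI; rewrite -(perm_mem p) mem_cat (negPf bC1) orbF.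
    case: (boolP (a \in C1)) => /= [aC1 _|aC1].
      move: bC; rewrite inE => /orP[/eqP -> //|bp].
      by move: ab; rewrite cross_C1_Cp.
    have aC : a \in r :: Cp by move: aI; rewrite -(perm_mem p) mem_cat (negPf aC1) orbF.
    exact: cl.
  have := cI cl' (mem_head r R) (sub1 c cC); rewrite /X' Xr orbT => /(_ isT)/orP[cC1|//].
  move: cC; rewrite inE => /orP[/eqP -> //|]; by rewrite mem_filter cC1.
(* A chord of [C1] crossing the root has one end counted by [k] and one end not, which gives
   [0 < k < 2|C1|]. *)
have [f fC1 /andP[f1 f2]] := C1_cross_root.
exists (hmap hLi r), (map (hmap hLi) Cp), D, k; split=> //.
- by apply/(conn_hmap hLM); rewrite -/(gL k) eC.
- by apply/(conn_hmap hRM); rewrite -/(gR n k) eD; apply: component_conn.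
split.
- by rewrite -has_count; apply/hasP; exists f.1; rewrite ?mem_endpoints1.
- rewrite size_map -size_endpoints -/E1 ltn_neqAle count_size andbT -all_count.
  by apply/allPn; exists f.2; rewrite ?mem_endpoints2 // -leqNgt ltnW.
apply/esym/sortC_eq; rewrite -/C'; last exact: wf_sorted wI.
  apply: perm_endpoints_uniq_fst uIe; by rewrite insertCD_hmap // sC' eC eD.
by rewrite insertCD_hmap // sC' eC eD.
Qed.

End Decompose.

(** Otherwise the chords ending at or before [k] form a crossing-closed set that contains the
    endpoint 1 but not the last endpoint. *)
Lemma conn_straddle D k : wf D -> conn D -> 0 < k < (size D).*2 ->
  exists2 d : chord, d \in D & d.1 <= k < d.2.
Proof.
move=> wD cD /andP[k0 kD]; apply/hasP; apply: contraT => /hasPn H.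
have cl : cross_closed D [pred d : chord | d.2 <= k].
  move=> a b aD bD; have := H b bD; have := wf_lt wD aD; have := wf_lt wD bD.
  by rewrite /= /cross; clear; lia.
have : 1 \in endpoints D by rewrite wf_mem_endpoints //; move: kD k0; clear; lia.
have : (size D).*2 \in endpoints D by rewrite wf_mem_endpoints // leqnn andbT; move: kD k0; clear; lia.
case/endpointsP => b bD eb /endpointsP[a aD ea].
have : b.2 <= k.
  apply: (cD _ cl a b aD bD) => /=; have := H a aD; have := wf_lt wD aD.
  by move: k0; case: ea => <-; clear; lia.
by have := wf_lt wD bD; move: kD; case: eb => ->; clear; lia.
Qed.

Section InsertParts.
Variables (r : chord) (C0 D : seq chord) (k : nat).
Hypotheses (wC : wf (r :: C0)) (wD : wf D) (k0 : 0 < k) (kD : k < (size D).*2).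
Hypotheses (cC : conn (r :: C0)) (cD : conn D).
Let C := r :: C0.
Let n := size C.
Let n0 : 0 < n. Proof. by []. Qed.
Let hLM := hL_mono k.
Let hRM := @hR_mono n k n0.

(** The two connected images are linked by a chord of [D] straddling [k], which crosses the root. *)
Lemma insertS_conn : conn (insertS C k D).
Proof.
have mI := perm_mem (insertS_perm D k wC).
have subL (c : chord) : c \in map (gL k) C -> c \in insertS C k D by rewrite mI mem_cat => ->.
have subR (c : chord) : c \in map (gR n k) D -> c \in insertS C k D.
  by rewrite mI mem_cat orbC => ->.
have gC : gL k r \in map (gL k) C by rewrite map_f ?mem_head.
have /(conn_hmap hLM) cL := cC; have /(conn_hmap hRM) cR := cD.
apply: (conn_from (subL _ gC)) => X cl Xr c; rewrite mI mem_cat => /orP[cI|cI].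
  by apply: (cL X) gC cI Xr => a b aC bC; apply: cl; apply: subL.
have [|d dD dk] := @conn_straddle D k wD cD; first by rewrite k0.
have gd : gR n k d \in map (gR n k) D by rewrite map_f.
have clR : cross_closed (map (gR n k) D) X by move=> a b aD bD; apply: cl; apply: subR.
apply: (cR X clR _ _ gd cI).
by apply: (cl (gL k r)) (subL _ gC) (subR _ gd) _ Xr; rewrite (cross_root_gR wC wD k0 kD).
Qed.

Lemma sortC_insertS : sortC (insertS C k D) = gL k r :: insert_rest r C0 D k.
Proof. by rewrite sorted_sortC ?sortC_sorted // insertS_cons. Qed.

Lemma head_comps_insert_rest : head [::] (comps (insert_rest r C0 D k)) = map (gR n k) D.
Proof. by rewrite comps_insert_rest. Qed.

Lemma insertS_setminus : [seq c <- insertS C k D | c \notin map (gR n k) D] = map (gL k) C.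
Proof.
rewrite insertS_cons //= filter_insert_restL // ifT //.
apply/mapP => -[d dD e]; have := gL_root k wC; rewrite e => -[].
by have [d0 _ _] := wf_bounds wD dD; rewrite /hR; move: d0 n0; case: (leqP d.1 k); clear; lia.
Qed.

(** The root of the result is [(1, r.2 + k)], and it is the only chord starting at 1, so [k] can be
    read off. *)
Lemma insertS_index :
  head 0 [seq k' <- iota 1 (size D).*2.-1 | perm_eq (insertCD C k' D) (insertS C k D)] = k.
Proof.
rewrite (_ : filter _ _ = [:: k]) //.
rewrite -(@filter_pred1_uniq _ (iota 1 (size D).*2.-1) k) ?iota_uniq //; last first.
  by rewrite mem_iota; move: k0 kD; clear; lia.
apply: eq_in_filter => k' _; apply/idP/eqP => [p|->]; last by rewrite perm_sym perm_sortC.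
have : gL k' r \in insertS C k D.
  by rewrite -(perm_mem p) insertCD_hmap // mem_cat map_f ?mem_head.
have : gL k r \in insertS C k D by rewrite insertS_cons // mem_head.
move=> i1 i2; have := uniq_fst_inj (wf_uniq_fst (insertS_wf wC wD k0 kD)) i1 i2.
rewrite !(gL_root _ wC) => /(_ erefl)[]; clear; lia.
Qed.

End InsertParts.

(** * Insertion trees *)

Fixpoint leaves (t : btree) : seq chord :=
  match t with BLeaf c => [:: c] | BNode l r => leaves l ++ leaves r end.

Lemma leaves_nus t r : map fst (nus t r) = leaves t.
Proof. by elim: t r => //= l IHl t IHt r; rewrite map_cat IHl IHt. Qed.

Lemma leaves_tmap f t : leaves (tmap f t) = map f (leaves t).
Proof. by elim: t => //= l -> t ->; rewrite map_cat. Qed.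

Lemma eq_in_tmap f g t : {in leaves t, f =1 g} -> tmap f t = tmap g t.
Proof.
elim: t => [c|l IHl t IHt] /= H; first by rewrite H ?mem_head.
by rewrite IHl ?IHt // => c cl; rewrite H // mem_cat cl ?orbT.
Qed.

Lemma tmap_comp f g t : tmap f (tmap g t) = tmap (f \o g) t.
Proof. by elim: t => //= l -> t ->. Qed.

Lemma tsize_tmap f t : Defs.tsize (tmap f t) = Defs.tsize t.
Proof. by elim: t => //= l -> t ->. Qed.

Lemma tsize_leaves t : Defs.tsize t = (size (leaves t)).*2.-1.
Proof.
have H u : (Defs.tsize u).+1 = (size (leaves u)).*2.
  elim: u => //= l IHl u IHu; rewrite size_cat doubleD -IHl -IHu; lia.
by rewrite -H.
Qed.

Lemma tmap_tinsert f T k T' : tmap f (tinsert T k T') = tinsert (tmap f T) k (tmap f T').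
Proof.
elim: T' k => [c|l IHl t IHt] k /=; case: eqP => //= _.
by rewrite tsize_tmap; case: leqP => /= _; rewrite ?IHl ?IHt.
Qed.

Lemma leaves_tinsert T k T' : 0 < k <= Defs.tsize T' ->
  perm_eq (leaves (tinsert T k T')) (leaves T ++ leaves T').
Proof.
elim: T' k => [c|l IHl t IHt] k /=.
  by case: eqP => // k1 /andP[k0 k1']; lia.
case: eqP => //= k1 kt; case: leqP => kl /=.
  rewrite catA perm_cat2r; apply: IHl; lia.
apply: (@perm_trans _ (leaves l ++ (leaves T ++ leaves t))).
  rewrite perm_cat2l; apply: IHt; lia.
by rewrite !catA perm_cat2r perm_catC.
Qed.

Lemma nth_map_index f (s : seq chord) c : c \in s -> nth (0, 0) (map f s) (index c s) = f c.
Proof. by move=> cs; rewrite (nth_map (0, 0)) ?index_mem // nth_index. Qed.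

(** [treeOf] restores the original chords by position lookup, which is meaningful only at chords
    that occur; hence the two hypotheses on leaves. *)
Lemma treeOf_insertS f r C0 D k :
  wf (r :: C0) -> wf D -> 0 < k -> k < (size D).*2 -> conn D ->
  {subset leaves (treeOf f (r :: C0)) <= r :: C0} -> {subset leaves (treeOf f D) <= D} ->
  treeOf f.+1 (insertS (r :: C0) k D) =
  tinsert (tmap (gL k) (treeOf f (r :: C0))) k
          (tmap (gR (size (r :: C0)) k) (treeOf f D)).
Proof.
move=> wC wD k0 kD cD sC sD; rewrite [treeOf _.+1 _]/= sortC_insertS //.
(* [D] is nonempty since [0 < k < 2|D|], so the recursive branch of [treeOf] applies. *)
case eR: (insert_rest r C0 D k) => [|c R].
  have := perm_size (insert_rest_perm r C0 D k); rewrite eR size_cat !size_map.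
  by move: kD; clear; case: (size D) => [|m]; rewrite ?addnS.
rewrite -eR head_comps_insert_rest // insertS_setminus // !norm_hmap //; last 2 first.
- exact: hR_mono.
- exact: hL_mono.
rewrite !norm_wf // insertS_index //; congr (tinsert _ _ _).
  by apply: eq_in_tmap => x /sC xC; rewrite nth_map_index.
by apply: eq_in_tmap => x /sD xD; rewrite nth_map_index.
Qed.

(** Induction along the root share decomposition: both parts are nonempty, hence strictly
    smaller. *)
Lemma connected_ind (P : seq chord -> Prop) :
  (forall r, wf [:: r] -> P [:: r]) ->
  (forall r C0 D k, wf (r :: C0) -> conn (r :: C0) -> wf D -> conn D ->
     0 < k -> k < (size D).*2 -> P (r :: C0) -> P D -> P (insertS (r :: C0) k D)) ->
  forall C, wf C -> conn C -> C != [::] -> P C.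
Proof.
move=> P1 PI C; have [m] := ubnP (size C); elim: m C => // m IH [|r [|c R]] // lt wC cC _.
  exact: P1.
have [//|r' [C0 [D [k [wC' cC' wD cD [k0 kD e]]]]]] := decompose_insertS wC cC.
have sz := size_insertS D k wC'; rewrite -e in sz.
rewrite e; apply: PI => //; apply: IH => //.
- move: sz kD lt; clear; rewrite /=; case: (size D) => [|s] //=; lia.
- move: sz kD lt; clear; rewrite /=; lia.
- by case: (D) kD.
Qed.

(** Independence of fuel and the description of the leaves are proved together, because the
    recursion step for trees needs the leaves of both parts. *)
Lemma treeOf_spec C : wf C -> conn C -> C != [::] ->
  forall f, size C <= f -> treeOf f C = insTree C /\ perm_eq (leaves (treeOf f C)) C.
Proof.
move: C; apply: connected_ind => [r w|r C0 D k wC cC wD cD k0 kD IHC IHD].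
  by case=> // f _; rewrite /insTree /= sorted_sortC.
have sz := size_insertS D k wC.
have step f : size (r :: C0) <= f -> size D <= f ->
    treeOf f.+1 (insertS (r :: C0) k D) =
      tinsert (tmap (gL k) (insTree (r :: C0))) k
        (tmap (gR (size (r :: C0)) k) (insTree D)) /\
    perm_eq (leaves (treeOf f.+1 (insertS (r :: C0) k D))) (insertS (r :: C0) k D).
  move=> fC fD; have [eC pC] := IHC f fC; have [eD pD] := IHD f fD.
  have -> : treeOf f.+1 (insertS (r :: C0) k D) =
      tinsert (tmap (gL k) (insTree (r :: C0))) k
        (tmap (gR (size (r :: C0)) k) (insTree D)).
    by rewrite treeOf_insertS // ?eC ?eD // => c;
       rewrite -?eC -?eD ?(perm_mem pC) ?(perm_mem pD).
  split=> //; rewrite perm_sym (perm_trans (insertS_perm D k wC)) // perm_sym.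
  apply: perm_trans (leaves_tinsert _ _) _; rewrite ?leaves_tmap.
    have sD : size (leaves (insTree D)) = size D by rewrite -eD; apply: perm_size pD.
    by rewrite k0 tsize_tmap tsize_leaves sD -ltnS (leq_trans kD) // leqSpred.
  by rewrite perm_cat // perm_map // -?eC -?eD.
have [m em] : exists m, size (insertS (r :: C0) k D) = m.+1 by rewrite sz; eexists.
have mC : size (r :: C0) <= m /\ size D <= m.
  by move: em kD; rewrite sz /=; clear; case: (size D) => [|s] //=; lia.
case=> [|f] lef; first by rewrite em in lef.
rewrite em ltnS in lef; case: mC => mC mD.
have [e1 p] := step f (leq_trans mC lef) (leq_trans mD lef).
have [e2 _] := step m mC mD; split=> //.
by rewrite e1 /insTree em e2.
Qed.

Lemma leaves_insTree C : wf C -> conn C -> C != [::] -> perm_eq (leaves (insTree C)) C.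
Proof. by move=> wC cC C0; have [] := treeOf_spec wC cC C0 (leqnn _). Qed.

Lemma insTree_insertS r C0 D k :
  wf (r :: C0) -> conn (r :: C0) -> wf D -> conn D -> 0 < k -> k < (size D).*2 ->
  insTree (insertS (r :: C0) k D) =
  tinsert (tmap (gL k) (insTree (r :: C0))) k
          (tmap (gR (size (r :: C0)) k) (insTree D)).
Proof.
move=> wC cC wD cD k0 kD; have sz := size_insertS D k wC.
have D0 : D != [::] by case: (D) kD.
have C0' : r :: C0 != [::] by [].
have [m em] : exists m, size (insertS (r :: C0) k D) = m.+1 by rewrite sz; eexists.
have [mC mD] : size (r :: C0) <= m /\ size D <= m.
  by move: em kD; rewrite sz /=; clear; case: (size D) => [|s] //=; lia.
have [eC pC] := treeOf_spec wC cC C0' mC; have [eD pD] := treeOf_spec wD cD D0 mD.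
rewrite {1}/insTree em treeOf_insertS ?eC ?eD // => c; first by rewrite -eC (perm_mem pC).
by rewrite -eD (perm_mem pD).
Qed.

(** * Labels and decorations under insertion *)

Lemma perm_iord C : perm_eq (iord C) C.
Proof.
have [m] := ubnP (size C); elim: m C => // m IH C lt.
have := size_sortC C; have := perm_sortC C.
case eC: (sortC C) => [|r R] p sz.
  by case: C {p eC lt} sz.
rewrite (iord_cons eC); apply: perm_trans p; rewrite perm_cons.
apply: perm_trans (comps_perm R).
have H K : K \in comps R -> perm_eq (iord K) K.
  move=> /size_comps KR; apply: IH; rewrite -ltnS; apply: leq_trans lt.
  by rewrite -sz !ltnS.
elim: (comps R) H => //= K Ks IHK H; rewrite perm_cat ?H ?mem_head // IHK // => K' K'K.
by apply: H; rewrite inE K'K orbT.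
Qed.

Lemma size_iord C : size (iord C) = size C.
Proof. exact: perm_size (perm_iord C). Qed.

Lemma iord_root r C0 : wf (r :: C0) ->
  iord (r :: C0) = r :: behead (iord (r :: C0)) /\ perm_eq (behead (iord (r :: C0))) C0.
Proof.
move=> w; have := perm_iord (r :: C0).
rewrite (iord_cons (sorted_sortC (wf_sorted w))) /=.
by rewrite perm_cons.
Qed.

(** Mirrors the intersection order of an inserted diagram ([iord_insertS]): root of [C'], then
    [C''], then the rest of [C']. *)
Definition dword (u v : seq nat) : seq nat := head 0 u :: v ++ behead u.

(** Each leaf is overwritten by its decoration, stored in the first component of a dummy chord. The
    endpoint shifts disappear, and insertion of diagrams becomes plain [tinsert]. *)
Definition dtree (C : seq chord) (w : seq nat) : btree :=
  tmap (fun c => (nth 0 w (index c (iord C)), 0)) (insTree C).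

Fixpoint tflags (L : seq chord) : seq bool :=
  match L with
  | [::] => [::]
  | c :: L' => ~~ has (cross^~ c) L' :: tflags L'
  end.

Lemma size_tflags L : size (tflags L) = size L.
Proof. by elim: L => //= c L ->. Qed.

Lemma tflags_hmap h L : {mono h : x y / x <= y} -> tflags (map (hmap h) L) = tflags L.
Proof.
move=> hM; elim: L => //= c L ->; rewrite has_map; congr (~~ _ :: _).
by apply: eq_has => d; rewrite /= cross_hmap.
Qed.

Lemma tflags_cat L1 L2 : (forall c d, c \in L1 -> d \in L2 -> cross d c = false) ->
  tflags (L1 ++ L2) = tflags L1 ++ tflags L2.
Proof.
elim: L1 => //= c L1 IH H; rewrite IH => [|d e dL eL]; last by rewrite H // inE dL orbT.
rewrite has_cat [has _ L2](_ : _ = false) ?orbF //.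
by apply/hasPn => d dL; rewrite H // mem_head.
Qed.

Section DecoratedInsert.
Variables (r : chord) (C0 D : seq chord) (k : nat) (u v : seq nat).
Hypotheses (wC : wf (r :: C0)) (cC : conn (r :: C0)) (wD : wf D) (cD : conn D).
Hypotheses (k0 : 0 < k) (kD : k < (size D).*2).
Let C := r :: C0.
Hypotheses (su : size u = size C) (sv : size v = size D).
Let n := size C.
Let n0 : 0 < n. Proof. by []. Qed.
Let B := behead (iord C).
Let hLM := hL_mono k.
Let hRM := @hR_mono n k n0.

Let gR_notin_gL (c d : chord) : c \in C -> d \in D -> gL k c != gR n k d.
Proof.
move=> cI dI; have := map_uniq (wf_uniq_fst (insertS_wf wC wD k0 kD)).
rewrite (perm_uniq (insertS_perm D k wC)) cat_uniq => /and3P[_ /hasPn H _].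
apply/eqP => e; case/negP: (H (gR n k d) (map_f _ dI)); rewrite -e.
exact: (map_f (gL k) cI).
Qed.

Lemma dtree_insertS :
  dtree (insertS C k D) (dword u v) = tinsert (dtree C u) k (dtree D v).
Proof.
have D0 : D != [::] by case: (D) kD.
have [eB pB] := iord_root wC; rewrite -/C -/B in eB pB.
rewrite /dtree insTree_insertS // tmap_tinsert !tmap_comp iord_insertS //.
congr (tinsert _ _ _); apply: eq_in_tmap => c; rewrite (perm_mem (leaves_insTree _ _ _)) // => cI /=;
  congr (_, _).
  rewrite eB /= [gL k r == _](inj_eq (hmap_inj hLM)); case: (eqVneq r c) => [_|rc] /=.
    by rewrite nth0.
  rewrite index_cat ifN; last first.
    by apply/mapP => -[d]; rewrite (perm_mem (perm_iord D)) => dD /eqP; apply/negP/gR_notin_gL.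
  rewrite size_map size_iord index_map; last exact: hmap_inj.
  rewrite nth_cat sv ifN; last by rewrite -leqNgt leq_addr.
  by rewrite addKn nth_behead.
rewrite (negPf (gR_notin_gL _ _)) ?mem_head // index_cat ifT; last first.
  by rewrite map_f ?(perm_mem (perm_iord D)).
rewrite index_map; last exact: hmap_inj.
by rewrite /= nth_cat sv -size_iord index_mem (perm_mem (perm_iord D)) cI.
Qed.

(** The root meets a later chord, namely one of [D] straddling [k]; chords of [D] meet none of the
    later chords of [C0]. The flag that the root has in [C] is lost, which the monomial will
    tolerate. *)
Lemma tflags_insertS :
  tflags (iord (insertS C k D)) = false :: tflags (iord D) ++ tflags B.
Proof.
rewrite iord_insertS //=; congr cons.
  have [|d dD dk] := @conn_straddle D k wD cD; first by rewrite k0.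
  apply/negbTE; rewrite negbK; apply/hasP; exists (gR n k d).
    by rewrite mem_cat map_f // (perm_mem (perm_iord D)).
  by rewrite /= crossC (cross_root_gR wC wD k0 kD).
have [_ pB] := iord_root wC; rewrite -/C -/B in pB.
rewrite tflags_cat ?tflags_hmap // => _ _ /mapP[d dD ->] /mapP[c cB ->].
rewrite (perm_mem (perm_iord D)) in dD; rewrite (perm_mem pB) in cB.
exact: (cross_gL_gR wC wD).
Qed.

End DecoratedInsert.

(** * Involutions and normalized diagrams *)

Section Involutions.
Variables (m : nat).
Implicit Type sg : {perm 'I_(m.*2)}.

Lemma is_cdP sg : is_cd sg -> (forall i, sg (sg i) = i) /\ (forall i, sg i != i).
Proof. by move/forallP => H; split=> i; have /andP[/eqP] := H i. Qed.

Lemma mem_chords_of sg (i j : 'I_(m.*2)) :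
  (((val i).+1, (val j).+1) \in chords_of sg) = (val i < val j) && (sg i == j).
Proof.
apply/mapP/andP => [[i']|[ij /eqP sij]].
  rewrite mem_filter => /andP[ii' _] [/val_inj -> /val_inj ->].
  by rewrite eqxx.
by exists i; [rewrite mem_filter sij mem_enum andbT | rewrite sij].
Qed.

Lemma chords_of_endpoints sg : is_cd sg ->
  perm_eq (endpoints (chords_of sg)) (iota 1 m.*2).
Proof.
case/is_cdP => inv nfix; apply: perm_trans (endpoints_fst_snd _) _.
set F := [seq j <- enum 'I_(m.*2) | val j < val (sg j)].
have -> : map fst (chords_of sg) = map (S \o val) F by rewrite -map_comp.
have -> : map snd (chords_of sg) = map (S \o val) (map sg F) by rewrite -!map_comp.
have -> : iota 1 m.*2 = map (S \o val) (enum 'I_(m.*2)).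
  by rewrite map_comp val_enum_ord (iotaDl 1 0).
rewrite -map_cat; apply: perm_map; apply: uniq_perm.
- have uF : uniq F by rewrite filter_uniq ?enum_uniq.
  rewrite cat_uniq (map_inj_uniq perm_inj) uF andbT /=.
  apply/hasPn => _ /mapP[i iF ->]; move: iF; rewrite !mem_filter inv.
  by case/andP => lt _; rewrite negb_and -leqNgt ltnW.
- exact: enum_uniq.
move=> i; rewrite mem_enum mem_cat mem_filter mem_enum andbT.
case: ltngtP => //= h.
  apply/mapP; exists (sg i); rewrite ?inv // mem_filter inv mem_enum andbT; exact: h.
by case/negP: (nfix i); apply/eqP/val_inj.
Qed.

Lemma size_chords_of sg : is_cd sg -> size (chords_of sg) = m.
Proof.
move=> cd; have := perm_size (chords_of_endpoints cd).
by rewrite size_endpoints size_iota => /double_inj.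
Qed.

Lemma chords_of_wf sg : is_cd sg -> wf (chords_of sg).
Proof.
move=> cd; apply/and3P; split; last by rewrite size_chords_of ?chords_of_endpoints.
  rewrite sorted_map; apply: sorted_filter => [i j k|]; first exact: lec_trans.
  have : sorted leq (map val (enum 'I_(m.*2))) by rewrite val_enum_ord iota_sorted.
  by rewrite sorted_map.
by apply/allP => _ /mapP[i + ->]; rewrite mem_filter => /andP[].
Qed.

(** The chords give the value at each left end; the involution then gives it at each right end. *)
Lemma chords_of_inj sg sg' : is_cd sg -> is_cd sg' -> chords_of sg = chords_of sg' -> sg = sg'.
Proof.
move=> /is_cdP[inv nfix] /is_cdP[inv' _] e; apply/permP => i.
have H j : val j < val (sg j) -> sg' j = sg j.
  move=> lt; have : ((val j).+1, (val (sg j)).+1) \in chords_of sg by rewrite mem_chords_of lt eqxx.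
  by rewrite e mem_chords_of => /andP[_ /eqP].
case: (ltngtP (val i) (val (sg i))) => [lt|gt|eq].
- by rewrite H.
- by rewrite -[i in RHS]inv -(H (sg i)) ?inv ?inv'.
by case/negP: (nfix i); apply/eqP/val_inj.
Qed.

Lemma chords_of_surj D : wf D -> size D = m -> exists2 sg : {perm 'I_(m.*2)}, is_cd sg & chords_of sg = D.
Proof.
move=> wD sD.
pose P x := fun c : chord => (c.1 == x) || (c.2 == x).
pose partner x := let c := nth (0, 0) D (find (P x) D) in if c.1 == x then c.2 else c.1.
have uniqP (c d : chord) x : c \in D -> d \in D -> P x c -> P x d -> c = d.
  move=> cD dD; case: (eqVneq c d) => // ne; have [n1 n2 n3 n4] := wf_neq_endpoints wD cD dD ne.
  by rewrite /P => /orP[] /eqP e1 /orP[] /eqP e2; congruence.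
have pE (c : chord) x : c \in D -> P x c -> partner x = if c.1 == x then c.2 else c.1.
  move=> cD Pc; rewrite /partner; have h : has (P x) D by apply/hasP; exists c.
  suff -> : nth (0, 0) D (find (P x) D) = c by [].
  apply: (uniqP _ _ x) => //; [by rewrite mem_nth // -has_find | exact: nth_find].
have p1 (c : chord) : c \in D -> partner c.1 = c.2.
  by move=> cD; rewrite (pE c) ?eqxx // /P eqxx.
have p2 (c : chord) : c \in D -> partner c.2 = c.1.
  move=> cD; rewrite (pE c) // /P ?eqxx ?orbT //.
  by have := wf_lt wD cD; rewrite ltn_neqAle => /andP[/negPf ->].
(* Endpoints start at 1 and ordinals at 0, hence the shift; [valf] shows that the partner is in
   range. *)
pose f (i : 'I_(m.*2)) : 'I_(m.*2) := insubd i (partner i.+1).-1.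
have ordD (i : 'I_(m.*2)) : exists2 c : chord, c \in D & i.+1 = c.1 \/ i.+1 = c.2.
  by apply/endpointsP; rewrite wf_mem_endpoints // sD ltn_ord.
have valf i : (val (f i)).+1 = partner i.+1.
  have [c cD e] := ordD i; have [c1 c12 c2] := wf_bounds wD cD.
  have pb : 0 < partner i.+1 <= m.*2.
    rewrite sD in c2; case: e => ->; rewrite ?p1 ?p2 //.
      by rewrite c2 (ltn_trans c1).
    by rewrite c1 (leq_trans (ltnW c12)).
  case/andP: pb => p0 pm; rewrite val_insubd -ltnS prednK // ltnS pm prednK //.
have finv : involutive f.
  move=> i; apply: val_inj; apply: succn_inj; rewrite valf valf.
  by have [c cD [] ->] := ordD i; rewrite ?p1 ?p2 // ?p1 ?p2.
pose sg := perm (inv_inj finv).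
have cd : is_cd sg.
  apply/forallP => i; rewrite !permE finv eqxx /=; apply/eqP => /(congr1 val)/(congr1 S).
  rewrite valf; have [c cD] := ordD i; have := wf_lt wD cD.
  by move=> lt [] e; rewrite e ?p1 ?p2 // => e'; move: lt; rewrite e' ltnn.
exists sg => //.
have sub : {subset D <= chords_of sg}.
  move=> c cD; have [c1 c12 c2] := wf_bounds wD cD.
  have c20 := ltn_trans c1 c12; rewrite sD in c2.
  have b1 : c.1.-1 < m.*2 by rewrite prednK // (leq_trans (ltnW c12)).
  have b2 : c.2.-1 < m.*2 by rewrite prednK.
  have e : ((val (Ordinal b1)).+1, (val (Ordinal b2)).+1) = c.
    by rewrite /= !prednK //; case: (c).
  rewrite -e mem_chords_of /= -ltnS !prednK // c12 /= permE.
  by apply/eqP/val_inj/succn_inj; rewrite valf /= !prednK // p1.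
have sz : size (chords_of sg) <= size D by rewrite size_chords_of // sD.
have [_ e] := uniq_min_size (wf_uniq wD) sub sz.
have p : perm_eq (chords_of sg) D.
  apply: uniq_perm; [exact: wf_uniq (chords_of_wf cd)|exact: wf_uniq wD|].
  by move=> c; rewrite e.
rewrite -(sorted_sortC (wf_sorted (chords_of_wf cd))).
by apply: sortC_eq (wf_sorted wD) => //; apply: wf_uniq_fst (chords_of_wf cd).
Qed.

End Involutions.

(** * The bijection on decorated diagrams *)

Lemma uniq_flatten_key (K T : eqType) (f : K -> seq T) (key : T -> K) s :
  uniq s -> {in s, forall x, uniq (f x)} -> {in s, forall x, {in f x, forall t, key t = x}} ->
  uniq (flatten (map f s)).
Proof.
elim: s => //= x s IH /andP[xs us] uf kf; rewrite cat_uniq uf ?mem_head //=.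
rewrite IH // => [|y ys|y ys]; first 1 last.
- by apply: uf; rewrite inE ys orbT.
- by apply: kf; rewrite inE ys orbT.
rewrite andbT; apply/hasPn => t /flatten_mapP[y ys ty]; apply: contra xs => tx.
by rewrite -(kf x (mem_head _ _) t tx) (kf y _ t ty) // inE ys orbT.
Qed.

Definition decs (m n : nat) : pred {ffun 'I_m -> 'I_n.+1} :=
  [pred d : {ffun 'I_m -> 'I_n.+1} |
    [forall j, 0 < val (d j)] && (\sum_(j < m) val (d j) == n)].

Definition cds (m : nat) : pred {perm 'I_(m.*2)} :=
  [pred sg | is_cd sg && connectedb (chords_of sg)].

Definition word (m n : nat) (d : {ffun 'I_m -> 'I_n.+1}) : seq nat :=
  [seq val (d j) | j <- enum 'I_m].

Definition decorated_of_size (n m : nat) : seq (seq chord * seq nat) :=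
  [seq (chords_of sg, word d) | sg <- enum (@cds m), d <- enum (@decs m n)].

Definition decorated (n : nat) : seq (seq chord * seq nat) :=
  flatten [seq decorated_of_size n m | m <- index_iota 1 n.+1].

Lemma mem_decorated n (p : seq chord * seq nat) :
  reflect [/\ wf p.1, conn p.1, p.1 != [::] & [/\ size p.2 = size p.1, all (ltn 0) p.2 & sumn p.2 = n]]
    (p \in decorated n).
Proof.
apply: (iffP flatten_mapP) => [[m mn /allpairsP[[sg d] [/= sgI dI ->]]]|].
  move: sgI dI; rewrite !mem_enum => /andP[cd cc] /andP[/forallP d0 /eqP dn].
  have w := chords_of_wf cd; have /(connectedP (wf_uniq w))[/eqP n0 c] := cc.
  split=> //; split=> /=.
  - by rewrite size_map size_enum_ord size_chords_of.
  - by apply/allP => _ /mapP[j _ ->]; apply: d0.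
  by rewrite sumnE big_map -[RHS]dn big_enum.
case: p => C w /= [wC cC C0 [sw w0 wn]].
(* Decorations are positive, so at most [n] chords occur and the range of [m] in [gcoef] misses no
   diagram. *)
have le : size w <= sumn w.
  elim: (w) w0 => //= x s IH /andP[x0 /IH]; rewrite /= in x0; lia.
have [sg cd e] := chords_of_surj wC (erefl _).
exists (size C).
  by rewrite mem_index_iota ltnS -wn -sw le andbT sw lt0n size_eq0.
have nthw i : nth 0 w i <= n.
  rewrite -wn; elim: (w) i => [|x s IH] [|i] //=; first exact: leq_addr.
  exact: leq_trans (IH i) (leq_addl _ _).
apply/allpairsP; exists (sg, [ffun j : 'I_(size C) => inord (nth 0 w j)]) => /=.
have ew : [seq val ([ffun j : 'I_(size C) => inord (nth 0 w j)] j : 'I_n.+1) | j <- enum 'I_(size C)] = w.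
  rewrite -[RHS](mkseq_nth 0) sw /mkseq -val_enum_ord -map_comp.
  by apply: eq_map => j; rewrite ffunE /= inordK // ltnS.
split.
- by rewrite mem_enum inE cd e; apply/connectedP => //; [exact: wf_uniq | split=> //; apply/eqP].
- rewrite mem_enum inE; apply/andP; split.
    apply/forallP => j; rewrite ffunE /= inordK ?ltnS //.
    by apply: (allP w0); rewrite mem_nth // sw.
  by rewrite -[X in _ == X]wn -[in X in _ == X]ew sumnE big_map big_enum.
by rewrite e /word ew.
Qed.

Lemma uniq_decorated n : uniq (decorated n).
Proof.
have sz m (p : seq chord * seq nat) : p \in decorated_of_size n m -> size p.1 = m.
  case/allpairsP => [[sg d] [/= sgI _ ->]].
  by move: sgI; rewrite mem_enum => /andP[cd _]; rewrite /= size_chords_of.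
apply: (@uniq_flatten_key _ _ _ (fun p => size p.1)) => [|m _|m _ p]; last exact: sz.
  exact: iota_uniq.
apply: allpairs_uniq; rewrite ?enum_uniq // => -[sg d] [sg' d'].
move=> /allpairsP[[x y] [/= xI yI [-> ->]]] /allpairsP[[x' y'] [/= x'I y'I [-> ->]]] [] e1 e2.
move: xI x'I; rewrite !mem_enum => /andP[cx _] /andP[cx' _].
congr (_, _); first exact: chords_of_inj e1.
apply/ffunP => j; apply: val_inj.
have /= := congr1 (fun s => nth 0 s j) e2.
by rewrite /word !(nth_map j) -?enumT ?size_enum_ord // !nth_ord_enum.
Qed.

(* A decorated diagram: its chords and the decorations in label order. *)
Definition dchord := (seq chord * seq nat)%type.

Definition dinsert (z : dchord * dchord * nat) : dchord :=
  (insertS z.1.1.1 z.2 z.1.2.1, dword z.1.1.2 z.1.2.2).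

(** The grouping follows the final computation: [p], then [q] of complementary total decoration give
    the Cauchy product, and the innermost index is the edge over which weights are summed. *)
Definition insertions_at (n : nat) (p : dchord) : seq (dchord * dchord * nat) :=
  flatten [seq [seq (p, q, j) | j <- index_iota 1 (size q.1).*2]
    | q <- decorated (n - sumn p.2)].

Definition decorated_upto (n : nat) : seq dchord :=
  flatten [seq decorated i | i <- index_iota 0 n.+1].

Definition insertions (n : nat) : seq (dchord * dchord * nat) :=
  flatten [seq insertions_at n p | p <- decorated_upto n].

Lemma mem_decorated_upto n (p : dchord) :
  (p \in decorated_upto n) = (sumn p.2 <= n) && (p \in decorated (sumn p.2)).
Proof.
apply/flatten_mapP/andP => [[i]|[pn pG]]; last first.
  by exists (sumn p.2); rewrite // mem_index_iota.
rewrite mem_index_iota ltnS => /andP[_ i_n] pG.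
by have /mem_decorated[_ _ _ [_ _ e]] := pG; rewrite e.
Qed.

Lemma mem_insertions n (p q : dchord) j :
  ((p, q, j) \in insertions n) =
  [&& sumn p.2 <= n, p \in decorated (sumn p.2), q \in decorated (n - sumn p.2)
    & 0 < j < (size q.1).*2].
Proof.
apply/flatten_mapP/and4P => [[p' p'I /flatten_mapP[q' q'I /mapP[j' + [-> -> ->]]]]|[pn pI qI jI]].
  by move: p'I; rewrite mem_decorated_upto mem_index_iota => /andP[].
exists p; first by rewrite mem_decorated_upto pn.
apply/flatten_mapP; exists q => //; apply/mapP; exists j => //; by rewrite mem_index_iota.
Qed.

Lemma uniq_insertions n : uniq (insertions n).
Proof.
apply: (@uniq_flatten_key _ _ _ (fun z => z.1.1)) => [|p _|p _ z].
- apply: (@uniq_flatten_key _ _ _ (fun p : dchord => sumn p.2)) => [|i _|i _ p].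
  + exact: iota_uniq.
  + exact: uniq_decorated.
  + by case/mem_decorated => _ _ _ [].
- apply: (@uniq_flatten_key _ _ _ (fun z => z.1.2)) => [|q _|q _ z].
  + exact: uniq_decorated.
  + by rewrite map_inj_uniq ?iota_uniq // => j j' [].
  + by case/mapP => j _ ->.
- by case/flatten_mapP => q _ /mapP[j _ ->].
Qed.

Lemma dword_inj u v u' v' : 0 < size u -> size u = size u' -> size v = size v' ->
  dword u v = dword u' v' -> (u, v) = (u', v').
Proof.
case: u u' => [|d u] [|d' u'] //= _ _ sv [-> /eqP]; rewrite eqseq_cat //.
by case/andP => /eqP -> /eqP ->.
Qed.

(** [D] is the first component left after deleting the root, [C] is the complement of that
    component, both up to [norm], and the root then determines [k]. *)
Lemma insertS_inj r C0 D k r' C0' D' k' :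
  wf (r :: C0) -> wf D -> conn D -> 0 < k < (size D).*2 ->
  wf (r' :: C0') -> wf D' -> conn D' -> 0 < k' < (size D').*2 ->
  insertS (r :: C0) k D = insertS (r' :: C0') k' D' ->
  [/\ r :: C0 = r' :: C0', D = D' & k = k'].
Proof.
move=> wC wD cD /andP[k0 kD] wC' wD' cD' /andP[k0' kD'] e.
have eR : insert_rest r C0 D k = insert_rest r' C0' D' k'.
  by have := e; rewrite !insertS_cons // => -[].
have e1 : map (gR (size (r :: C0)) k) D = map (gR (size (r' :: C0')) k') D'.
  by rewrite -!head_comps_insert_rest // eR.
have eC : r :: C0 = r' :: C0'.
  rewrite -(norm_wf wC) -(norm_hmap (hL_mono k)) -(insertS_setminus wC wD k0 kD) e e1.
  by rewrite (insertS_setminus wC' wD' k0' kD') (norm_hmap (hL_mono k')) norm_wf.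
have eD : D = D'.
  have hR1 : {mono hR (size (r :: C0)) k : x y / x <= y} by apply: hR_mono.
  have hR2 : {mono hR (size (r' :: C0')) k' : x y / x <= y} by apply: hR_mono.
  by rewrite -(norm_wf wD) -(norm_hmap hR1) [map _ D]e1 (norm_hmap hR2) norm_wf.
split=> //; rewrite -(insertS_index wC wD k0 kD) -[RHS](insertS_index wC' wD' k0' kD').
by rewrite -e -eD -eC.
Qed.

Lemma insertions_perm n :
  perm_eq [seq p <- decorated n | 1 < size p.1] (map dinsert (insertions n)).
Proof.
apply: uniq_perm; first by rewrite filter_uniq ?uniq_decorated.
  rewrite map_inj_in_uniq ?uniq_insertions // => -[[p q] j] [[p' q'] j'].
  rewrite !mem_insertions => /and4P[_ /mem_decorated[wp cp p0 [sp _ _]] /mem_decorated[wq cq _ [sq _ _]] jq].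
  move=> /and4P[_ /mem_decorated[wp' cp' p0' [sp' _ _]] /mem_decorated[wq' cq' _ [sq' _ _]] jq'].
  case: p p' q q' => [[|r C0] u] [[|r' C0'] v] [D u'] [D' v'] //= in wp cp p0 sp wq cq sq jq wp' cp' p0' sp' wq' cq' sq' jq' *.
  move=> E; have e : insertS (r :: C0) j D = insertS (r' :: C0') j' D' := congr1 fst E.
  have ew : dword u u' = dword v v' := congr1 snd E.
  have [eC eD ek] := insertS_inj wp wq cq jq wp' wq' cq' jq' e.
  have [u_v u'_v'] : (u, u') = (v, v').
    apply: dword_inj ew; [by rewrite sp | | by rewrite sq sq' eD].
    by rewrite sp sp' -[(size C0').+1]/(size (r' :: C0')) -eC.
  by case: eC => -> ->; rewrite eD ek u_v u'_v'.
move=> [I w]; rewrite mem_filter; apply/andP/mapP => [[/= I1 /mem_decorated[/= wI cI I0 [sw w0 wn]]]|].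
  case: I => [|r [|c R]] // in I1 wI cI I0 sw *.
  have [//|r' [C0 [D [k [wC' cC' wD cD [k0 kD e]]]]]] := decompose_insertS wI cI.
  rewrite e in sw *; rewrite size_insertS // in sw.
  case: w sw w0 wn => [|d w] //= sw /andP[d0 w0] wn.
  have sw' : size w = size C0 + size D by case: sw.
  have sDw : size D <= size w by rewrite sw' leq_addl.
  (* Inverse of [dword]: the first letter decorates the root, the next [|D|] letters belong to [D],
     and the others return to the first part. *)
  pose u := d :: drop (size D) w; pose v := take (size D) w.
  have su : size u = size (r' :: C0) by rewrite /= size_drop sw' addnK.
  have sv : size v = size D by rewrite size_takel.
  have suv : sumn u + sumn v = n.
    by rewrite -wn -[in RHS](cat_take_drop (size D) w) sumn_cat /u /v /=; lia.
  have au : all (ltn 0) u by rewrite /= d0; apply/allP => x /mem_drop/(allP w0).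
  have av : all (ltn 0) v by apply/allP => x /mem_take/(allP w0).
  exists ((r' :: C0, u), (D, v), k).
    rewrite mem_insertions /= k0 kD !andbT; apply/and3P; split.
    - by rewrite -suv leq_addr.
    - by apply/mem_decorated; split.
    - apply/mem_decorated; split=> //=; first by case: (D) kD.
      by split=> //; rewrite -suv addKn.
  by rewrite /dinsert /= /dword /= cat_take_drop.
case=> -[[[C u] [D v]] k]; rewrite mem_insertions /=.
move=> /and4P[un /mem_decorated[/= wC cC C0 [su u0 _]] /mem_decorated[/= wD cD D0 [sv v0 vn]] /andP[k0 kD]].
case: C => [|r C'] // in wC cC C0 su *; case=> -> ->.
have sI := size_insertS D k wC.
have D1 : 0 < size D by rewrite lt0n size_eq0.
split; first by rewrite sI /= ltnS (leq_trans D1) // leq_addl.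
apply/mem_decorated; split=> /=.
- exact: insertS_wf.
- exact: insertS_conn.
- by rewrite insertS_cons.
case: u su u0 un vn => [|d u] //= su /andP[d0 u0] un vn; split.
- by rewrite size_cat sI sv; case: su => ->; rewrite addnC.
- by rewrite d0 all_cat v0 u0.
- by rewrite sumn_cat vn -(subnKC un) /=; lia.
Qed.

(** * Weights *)

Local Open Scope ring_scope.

Definition leafw (s : int) (d v : nat) : rat := binq ((s * d%:Z)%:~R + v%:R - 2%:R) v.

Definition treew (s : int) (t : btree) (r : nat) : rat :=
  \prod_(p <- nus t r) leafw s p.1.1 p.2.

Definition tweight (t : btree) : nat := (\sum_(c <- leaves t) c.1)%N.

Lemma leafwS s d r :
  r.+1%:R * leafw s d r.+1 = ((s * d%:Z)%:~R + r%:R - 1) * leafw s d r.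
Proof.
rewrite /leafw; set y := (s * d%:Z)%:~R.
have -> : y + r.+1%:R - 2%:R = y + r%:R - 1 by rewrite -natr1; ring.
(* The factor of index 0 in the product is [y + r - 1]; the remaining ones are those of
   [leafw s d r]. *)
rewrite /binq big_ord_recl factS natrM.
have -> : \prod_(i < r) (y + r%:R - 1 - (lift ord0 i)%:R) = \prod_(j < r) (y + r%:R - 2%:R - j%:R).
  by apply: eq_bigr => i _; rewrite lift0 -natr1; ring.
rewrite /= subr0; set P := \prod_(i < r) _.
have N0 : (r.+1)%:R != 0 :> rat by rewrite pnatr_eq0.
have F0 : (r`!)%:R != 0 :> rat by rewrite pnatr_eq0 -lt0n fact_gt0.
by move: P (r.+1)%:R (r`!)%:R N0 F0 => P N F N0 F0; field; rewrite N0 F0.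
Qed.

Lemma treew_node s l t r : treew s (BNode l t) r = treew s l 0 * treew s t r.+1.
Proof. by rewrite /treew /= big_cat. Qed.

Lemma tweight_node l t : tweight (BNode l t) = (tweight l + tweight t)%N.
Proof. by rewrite /tweight /= big_cat. Qed.

(* The correction term on the left accounts for the [r] extra edges that the
   rightmost path of [T'] has above its root; it vanishes at [r = 0]. *)
Lemma sum_treew_tinsert s T T' r :
  \sum_(1 <= k < (Defs.tsize T').+1) treew s (tinsert T k T') r
    + r%:R * (treew s T 0 * treew s T' r.+1)
  = treew s T 0 * treew s T' r * ((s * (tweight T')%:Z)%:~R - 1 + r%:R).
Proof.
elim: T' r => [c|l IHl t IHt] r.
  rewrite big_nat1 /= treew_node.
  have H v : treew s (BLeaf c) v = leafw s c.1 v by rewrite /treew big_seq1.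
  have -> : tweight (BLeaf c) = c.1 by rewrite /tweight big_seq1.
  have := leafwS s c.1 r; rewrite !H -natr1 => E.
  have -> : treew s T 0 * leafw s c.1 r.+1 + r%:R * (treew s T 0 * leafw s c.1 r.+1) =
     treew s T 0 * ((r%:R + 1) * leafw s c.1 r.+1) by ring.
  rewrite E; ring.
have -> : (Defs.tsize (BNode l t)).+1 = (Defs.tsize l + Defs.tsize t).+2 by [].
(* The edges split as in the pre-order numbering: edge 1, then the [tsize l] edges ending in [l],
   then those ending in [t]. The edge above a child serves as its virtual edge. *)
rewrite big_ltn // big_add1 /=.
rewrite (big_cat_nat (n := (Defs.tsize l).+1)) //=; last by rewrite ltnS leq_addr.
have -> : \sum_(1 <= k < (Defs.tsize l).+1) treew s (tinsert T k.+1 (BNode l t)) r =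
   (\sum_(1 <= k < (Defs.tsize l).+1) treew s (tinsert T k l) 0) * treew s t r.+1.
  rewrite mulr_suml big_nat_cond [RHS]big_nat_cond; apply: eq_bigr => k /andP[/andP[k0 kl] _] /=.
  by rewrite eqSS (negbTE (lt0n_neq0 k0)) -ltnS kl treew_node.
have -> : \sum_((Defs.tsize l).+1 <= k < (Defs.tsize l + Defs.tsize t).+1)
     treew s (tinsert T k.+1 (BNode l t)) r =
   treew s l 0 * (\sum_(1 <= k < (Defs.tsize t).+1) treew s (tinsert T k t) r.+1).
  rewrite -[(Defs.tsize l).+1]add1n big_addn subSn ?leq_addr // addKn mulr_sumr.
  rewrite big_nat_cond [RHS]big_nat_cond; apply: eq_bigr => k /andP[/andP[k0 kl] _].
  rewrite /= eqSS addn_eq0 (negbTE (lt0n_neq0 k0)) /= ifN; last first.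
    by rewrite -ltnNge -[ltnLHS]add0n ltn_add2r.
  by rewrite addnK treew_node.
have El := IHl 0%N; have Er := IHt r.+1.
move: El; rewrite mul0r addr0 => ->.
rewrite !treew_node tweight_node.
(* The correction for [t] at depth [r + 1] has coefficient [r + 1]. It cancels the term of edge 1
   together with the [r] copies in the correction for the whole tree. *)
have -> : treew s l 0 * (\sum_(1 <= k < (Defs.tsize t).+1) treew s (tinsert T k t) r.+1) =
  treew s l 0 * (treew s T 0 * treew s t r.+1 * ((s * (tweight t)%:Z)%:~R - 1 + r.+1%:R)
    - r.+1%:R * (treew s T 0 * treew s t r.+2)).
  by rewrite -Er addrK.
have -> : (s * (tweight l + tweight t)%N%:Z)%:~R =
    (s * (tweight l)%:Z)%:~R + (s * (tweight t)%:Z)%:~R :> rat.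
  by rewrite PoszD mulrDr intrD.
rewrite -natr1; ring.
Qed.

(** The weight runs over labels and looks each [nu] up among the leaves. Leaves are distinct and
    form a permutation of the label order, so the product can run over leaves. *)
Lemma omega_dtree s C w : wf C -> conn C -> C != [::] ->
  omega s C (fun i => nth 0%N w i.-1) = treew s (dtree C w) 0.
Proof.
move=> wC cC C0; have pL := leaves_insTree wC cC C0; have pI := perm_iord C.
have nusE f t r : nus (tmap f t) r = [seq (f p.1, p.2) | p <- nus t r].
  by elim: t r => //= l IHl t IHt r; rewrite IHl IHt map_cat.
rewrite /treew nusE big_map /=.
set N := nus (insTree C) 0.
pose lk c := nth 0%N (map snd N) (index c (map fst N)).
have NL : map fst N = leaves (insTree C) by apply: leaves_nus.
have uN : uniq (map fst N) by rewrite NL (perm_uniq pL) wf_uniq.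
have -> : \prod_(p <- N) leafw s (nth 0%N w (index p.1 (iord C))) p.2 =
  \prod_(p <- N) leafw s (nth 0%N w (index p.1 (iord C))) (lk p.1).
  rewrite big_seq [RHS]big_seq; apply: eq_bigr => p pN; congr leafw; rewrite /lk.
  have ip : (index p N < size N)%N by rewrite index_mem.
  have -> : index p.1 (map fst N) = index p N.
    rewrite -{1}(nth_index p pN) -(nth_map p (0, 0)%N fst) //.
    by rewrite index_uniq ?size_map.
  by rewrite (nth_map p) // nth_index.
rewrite -(big_map fst xpredT (fun c => leafw s (nth 0%N w (index c (iord C))) (lk c))).
have pNI : perm_eq (map fst N) (iord C) by rewrite NL (perm_trans pL) // perm_sym.
rewrite (perm_big _ pNI) /= (big_nth (0, 0)%N) /omega big_add1 /= size_iord.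
rewrite big_nat_cond [RHS]big_nat_cond; apply: eq_bigr => i /andP[/andP[_ iC] _].
by rewrite index_uniq ?size_iord // (perm_uniq pI) wf_uniq.
Qed.

Lemma tweight_dtree C w : wf C -> conn C -> C != [::] -> size w = size C ->
  tweight (dtree C w) = sumn w.
Proof.
move=> wC cC C0 sw; rewrite /tweight /dtree leaves_tmap big_map /=.
have p : perm_eq (leaves (insTree C)) (iord C).
  by rewrite (perm_trans (leaves_insTree wC cC C0)) // perm_sym perm_iord.
rewrite (perm_big _ p) /= (big_nth (0, 0)%N) size_iord -sw sumnE [RHS](big_nth 0%N).
rewrite big_nat_cond [RHS]big_nat_cond; apply: eq_bigr => i /andP[/andP[_ iC] _].
by rewrite index_uniq ?size_iord ?(perm_uniq (perm_iord C)) ?wf_uniq // -sw.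
Qed.

Lemma sum_omega_insertS s r C0 D u v :
  wf (r :: C0) -> conn (r :: C0) -> wf D -> conn D -> D != [::] ->
  size u = size (r :: C0) -> size v = size D ->
  \sum_(1 <= k < (size D).*2)
     omega s (insertS (r :: C0) k D) (fun i => nth 0%N (dword u v) i.-1) =
  omega s (r :: C0) (fun i => nth 0%N u i.-1) * omega s D (fun i => nth 0%N v i.-1)
    * ((s * (sumn v)%:Z)%:~R - 1).
Proof.
move=> wC cC wD cD D0 su sv.
have := sum_treew_tinsert s (dtree (r :: C0) u) (dtree D v) 0.
rewrite mul0r !addr0 !omega_dtree // tweight_dtree // => <-.
have -> : (Defs.tsize (dtree D v)).+1 = (size D).*2.
  have sD : size (leaves (insTree D)) = size D by apply: perm_size (leaves_insTree wD cD D0).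
  rewrite tsize_tmap tsize_leaves sD prednK // double_gt0; by case: (D) D0.
rewrite big_nat_cond [RHS]big_nat_cond; apply: eq_bigr => k /andP[/andP[k0 kD] _].
rewrite omega_dtree ?dtree_insertS //; [exact: insertS_wf | exact: insertS_conn |].
by rewrite insertS_cons.
Qed.

(** * Monomials *)

Section Monomials.
Variables (A : comAlgType rat) (a : nat -> nat -> A).

(* [gap_prod g l] reads a list of (terminal?, decoration) pairs in label order;
   [g] is the distance from the previous terminal label to the current one. *)
Fixpoint gap_prod (g : nat) (l : seq (bool * nat)) : A :=
  match l with
  | [::] => 1
  | (b, d) :: l' => if b then a d g * gap_prod 1 l' else a d 0 * gap_prod g.+1 l'
  end.

(* [base_prod (k - 1)] is the monomial [ahat * a_(d_b, b - k)], which is [0] for [b < k]. *)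
Fixpoint base_prod (j : nat) (l : seq (bool * nat)) : A :=
  match j, l with
  | 0%N, _ => gap_prod 0 l
  | _.+1, [::] => 0
  | j'.+1, (b, d) :: l' => if b then 0 else a d 0 * base_prod j' l'
  end.

(** A terminal entry resets the gap to 1, so what follows it is independent of what precedes it. *)
Lemma gap_prod_cat g l d l2 :
  gap_prod g (rcons l (true, d) ++ l2) = gap_prod g (rcons l (true, d)) * gap_prod 1 l2.
Proof.
elim: l g => [|[[] d'] l IH] g /=; first by rewrite mulr1.
  by rewrite IH mulrA.
by rewrite IH mulrA.
Qed.

Lemma base_prod_cat j l d l2 :
  base_prod j (rcons l (true, d) ++ l2) = base_prod j (rcons l (true, d)) * gap_prod 1 l2.
Proof.
elim: l j => [|[b d'] l IH] [|j] /=; rewrite ?mul0r ?mulr1 //.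
  by have := gap_prod_cat 0 ((b, d') :: l) d l2; rewrite /=.
by case: b; rewrite ?mul0r // IH mulrA.
Qed.

Fixpoint tprod (dec : nat -> nat) (p : nat) (T : seq nat) : A :=
  match T with
  | [::] => 1
  | t :: T' => a (dec t) (t - p) * tprod dec t T'
  end.

(** [p] plays the role of the last terminal label seen and [x] that of the next label to read. *)
Lemma gap_prodE fl dec p x m : (p <= x)%N ->
  gap_prod (x - p) [seq (fl i, dec i) | i <- iota x m] =
  tprod dec p (filter fl (iota x m)) * \prod_(i <- iota x m | ~~ fl i) a (dec i) 0.
Proof.
elim: m p x => [|m IH] p x px /=; first by rewrite big_nil mulr1.
rewrite big_cons; case: (fl x) => /=.
  by rewrite -[1%N](subSnn x) IH // mulrA.
by rewrite -subSn // IH ?(leqW px) // mulrCA.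
Qed.

(** The labels below [K] are skipped and must be non-terminal; reading then restarts at label [K]
    with gap 0, so the first terminal label [b] receives index [b - K]. *)
Lemma base_prodE fl dec K x m : (x <= K)%N -> has fl (iota x m) ->
  base_prod (K - x) [seq (fl i, dec i) | i <- iota x m] =
  let T := filter fl (iota x m) in
  if (K <= head 0 T)%N then
    tprod dec (head 0 T) (behead T) * \prod_(i <- iota x m | ~~ fl i) a (dec i) 0
      * a (dec (head 0 T)) (head 0 T - K)
  else 0.
Proof.
elim: m x => [|m IH] x //= xK h; rewrite big_cons.
have := xK; rewrite leq_eqVlt => /orP[/eqP <-|ltK].
  rewrite subnn /=; case: (boolP (fl x)) h => fx /= h.
    by rewrite leqnn -[1%N](subSnn x) gap_prodE // subnn mulrC.
  rewrite -[1%N](subSnn x) gap_prodE //.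
  have : all (fun i => x < i)%N (filter fl (iota x.+1 m)).
    by apply/allP => i; rewrite mem_filter mem_iota => /and3P[].
  move: h; rewrite has_filter; case: (filter fl _) => //= t T _ /andP[xt _].
  by rewrite ltnW //; ring.
rewrite -(subnSK ltK) /=; case: (boolP (fl x)) h => fx /= h.
  by rewrite leqNgt ltK.
rewrite IH //=; case: ifP => _; [by ring | by rewrite mulr0].
Qed.

Lemma prod_zip_behead dec T :
  \prod_(p <- zip (behead T) T) a (dec p.1) (p.1 - p.2)%N = tprod dec (head 0%N T) (behead T).
Proof.
case: T => [|t T] /=; first by rewrite big_nil.
elim: T t => [|t' T IH] t /=; first by rewrite big_nil.
by rewrite big_cons IH.
Qed.

(** The last label has no later chord to cross. This provides both the existence of a base chord and
    the reset of the gap at the end of [D]. *)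
Lemma tflags_last L : L != [::] -> exists F, tflags L = rcons F true.
Proof.
elim: L => // c [|c' L] IH _; first by exists [::].
have [//|F e] := IH; exists (~~ has (cross^~ c) (c' :: L) :: F).
by rewrite rcons_cons -e.
Qed.

Lemma nth_tflags L i : (i < size L)%N ->
  nth false (tflags L) i = ~~ has (cross^~ (nth (0, 0)%N L i)) (drop i.+1 L).
Proof. by elim: L i => // c L IH [|i] iL /=; rewrite ?drop0 // IH. Qed.

Lemma drop_label (L : seq chord) i :
  [seq nth (0, 0)%N L j.-1 | j <- iota i.+1 (size L - i)] = drop i L.
Proof.
apply: (@eq_from_nth _ (0, 0)%N); first by rewrite size_map size_iota size_drop.
move=> j; rewrite size_map size_iota => jL.
by rewrite (nth_map 0%N) ?size_iota // nth_iota // nth_drop.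
Qed.

Definition tlist (C : seq chord) (w : seq nat) := zip (tflags (iord C)) w.

Lemma gterm_base_prod s k (C : seq chord) w : C != [::] -> size w = size C -> (0 < k)%N ->
  gterm s a k C (fun i => nth 0%N w i.-1) =
  omega s C (fun i => nth 0%N w i.-1) *: base_prod k.-1 (tlist C w).
Proof.
move=> C0 sw k0; rewrite /gterm.
set dec := fun i => _.
pose fl i := ~~ has (fun j => cross (chord_of C j) (chord_of C i)) (iota i.+1 (size C - i)).
have tl : tlist C w = [seq (fl i, dec i) | i <- iota 1 (size C)].
  rewrite /tlist.
  have flE : [seq fl i | i <- iota 1 (size C)] = tflags (iord C).
    have -> : iota 1 (size C) = map S (iota 0 (size C)) by rewrite (iotaDl 1 0).
    rewrite -map_comp -size_iord; apply: (@eq_from_nth _ false).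
      by rewrite size_map size_iota size_tflags.
    move=> i; rewrite size_map size_iota => iC.
    rewrite (nth_map 0%N) ?size_iota // nth_iota // add0n /= /fl /chord_of /= -size_iord.
    rewrite nth_tflags //; congr (~~ _).
    by have /= <- := drop_label (iord C) i.+1; rewrite has_map.
  have decE : [seq dec i | i <- iota 1 (size C)] = w.
    rewrite (iotaDl 1 0) -map_comp -sw -[RHS](mkseq_nth 0%N).
    by apply: eq_map => j; rewrite /= /dec add1n.
  by rewrite -flE -[in LHS]decE zip_map.
(* A terminal label must exist for [head] in [base] to return a label rather than its default 0. *)
have hT : has fl (iota 1 (size C)).
  have [|F e] := @tflags_last (iord C); first by rewrite -size_eq0 size_iord size_eq0.
  have : has id (map fst (tlist C w)).
    by rewrite /tlist -/unzip1 unzip1_zip ?size_tflags ?size_iord ?sw // e has_rcons.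
  by rewrite tl -map_comp has_map.
rewrite -[k.-1]subn1 tl base_prodE //= -/(terminals C) -/(base C).
case: ifP => _; last by rewrite scaler0.
rewrite /ahat prod_zip_behead; congr (_ *: (_ * _ * _)).
rewrite /index_iota subn1 /= big_seq_cond [RHS]big_seq_cond; apply: eq_bigl => i.
by case: (boolP (i \in _)) => //= iI; rewrite mem_filter iI andbT.
Qed.

(** The non-terminal root accounts for one level. After it [D] is read at level [j], and its
    terminal last chord hands over gap 1 to the rest of [C0]. *)
Lemma base_prod_insertS r C0 D k u v j :
  wf (r :: C0) -> wf D -> conn D ->
  (0 < k)%N -> (k < (size D).*2)%N -> size u = size (r :: C0) -> size v = size D ->
  base_prod j.+1 (tlist (insertS (r :: C0) k D) (dword u v)) =
  base_prod 0 (tlist (r :: C0) u) * base_prod j (tlist D v).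
Proof.
move=> wC wD cD k0 kD su sv; rewrite /tlist tflags_insertS // /dword /=.
have [eB _] := iord_root wC; rewrite eB.
case: u su => // d u _ /=.
have [|F eF] := @tflags_last (iord D).
  by rewrite -size_eq0 size_iord; case: (D) kD.
rewrite zip_cat ?size_tflags ?size_iord // eF.
have sF : size F = (size v).-1.
  by have := size_tflags (iord D); rewrite eF size_rcons size_iord sv => <-.
case/lastP: v sv sF => [|v e] sv sF; first by case: (D) kD sv.
rewrite size_rcons /= in sF.
rewrite zip_rcons // base_prod_cat.
(* Starting from gap 0, a terminal and a non-terminal root both give [a d 0] and pass on gap 1, so
   the lost flag does not affect the product. *)
by case: (~~ _) => /=; rewrite mulrAC !mulrA.
Qed.

(** The monomial does not depend on the edge [i], so it factors out and only the weights are
    summed. *)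
Lemma sum_gterm_insertS s r C0 D k u v :
  wf (r :: C0) -> conn (r :: C0) -> wf D -> conn D -> D != [::] ->
  size u = size (r :: C0) -> size v = size D -> (1 < k)%N ->
  \sum_(1 <= i < (size D).*2)
     gterm s a k (insertS (r :: C0) i D) (fun i => nth 0%N (dword u v) i.-1) =
  gterm s a 1 (r :: C0) (fun i => nth 0%N u i.-1) *
    (gterm s a k.-1 D (fun i => nth 0%N v i.-1) *~ (s * (sumn v)%:Z - 1)).
Proof.
move=> wC cC wD cD D0 su sv k1.
have k2 : (0 < k.-1)%N by rewrite -ltnS prednK // ltnW.
rewrite !gterm_base_prod //.
have -> : \sum_(1 <= i < (size D).*2)
     gterm s a k (insertS (r :: C0) i D) (fun i => nth 0%N (dword u v) i.-1) =
  \sum_(1 <= i < (size D).*2)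
     omega s (insertS (r :: C0) i D) (fun i => nth 0%N (dword u v) i.-1) *:
     (base_prod 0 (tlist (r :: C0) u) * base_prod k.-2 (tlist D v)).
  rewrite big_nat_cond [RHS]big_nat_cond; apply: eq_bigr => i /andP[/andP[i0 iD] _].
  rewrite gterm_base_prod; last exact: ltnW.
  - by rewrite -{1}(prednK k2) base_prod_insertS.
  - by rewrite insertS_cons.
  - by rewrite size_insertS // /dword /= size_cat size_behead su sv /= addnC.
rewrite -scaler_suml sum_omega_insertS //=.
rewrite -scaler_int -!scalerAl -!scalerAr !scalerA; congr (_ *: _).
by rewrite rmorphB /= mulrAC mulrA.
Qed.

End Monomials.

(** * Summation over all decorated diagrams *)

Lemma gcoef_decorated (A : comAlgType rat) s (a : nat -> nat -> A) k n :
  gcoef s a k n = \sum_(p <- decorated n) gterm s a k p.1 (fun i => nth 0%N p.2 i.-1).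
Proof.
rewrite /gcoef /decorated big_flatten big_map; apply: eq_bigr => m _.
rewrite /decorated_of_size big_flatten big_map big_enum /=; apply: eq_bigr => sg _.
(* [decf d] unfolds to the lookup in [word d], so the summands agree by conversion. *)
by rewrite big_map big_enum.
Qed.

(** The only chord has label 1 and is terminal, so the base is 1, below [k]. *)
Lemma gterm_single (A : comAlgType rat) s (a : nat -> nat -> A) k (p : dchord) n :
  p \in decorated n -> (1 < k)%N -> ~~ (1 < size p.1)%N ->
  gterm s a k p.1 (fun i => nth 0%N p.2 i.-1) = 0.
Proof.
case/mem_decorated => _ _; case: (p.1) => [|c [|]] // _ _ k1 _.
by rewrite /gterm /base /terminals /= leqNgt k1.
Qed.

(** The identity is read coefficientwise: the operator [s x d/dx - 1] multiplies the coefficient of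
    degree [n - i] by [s (n - i) - 1], and the outer product is a Cauchy product. *)
Theorem mainTheorem3 (A : comAlgType rat) (s : int) (a : nat -> nat -> A) (k : nat) :
  (2 <= k)%N ->
  forall n : nat,
    gcoef s a k n =
    \sum_(i < n.+1) gcoef s a 1 i * (gcoef s a k.-1 (n - i) *~ (s * (n - i)%:Z - 1)).
Proof.
move=> k1 n; rewrite gcoef_decorated.
rewrite (bigID (fun p : dchord => (1 < size p.1)%N)) /= [X in _ + X]big1_seq ?addr0; last first.
  by move=> p /andP[p1 pI]; apply: gterm_single pI k1 p1.
rewrite -big_filter (perm_big _ (insertions_perm n)) big_map /= /insertions big_flatten big_map.
(* The total decoration of the first part is the index [i] of the Cauchy product; for [i = 0] both
   sides are empty sums. *)
rewrite /decorated_upto big_flatten big_map big_mkord; apply: eq_bigr => i _.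
rewrite gcoef_decorated mulr_suml big_seq [RHS]big_seq; apply: eq_bigr => p pI.
have /mem_decorated[wp cp p0 [sp _ sump]] := pI.
rewrite /insertions_at big_flatten big_map sump gcoef_decorated mulrz_suml mulr_sumr.
rewrite big_seq [RHS]big_seq; apply: eq_bigr => q qI.
have /mem_decorated[wq cq q0 [sq _ sumq]] := qI.
rewrite big_map /dinsert /= -sumq.
case: p wp cp p0 sp {pI sump} => [[|r C0] u] // wp cp _ sp.
exact: sum_gterm_insertS.
Qed.
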